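(* Let $Y\sim N(\theta,\sigma^2 I_n)$. Let $g:\mathbb{R}^n\to\mathbb{R}^n$ be weakly differentiable, with $\nabla_i g_i$ the weak partial derivative of the $i$th component $g_i$ with respect to $y_i$, and suppose that for some $\beta>0$, $\mathbb{E}\|g(Y_\beta)\|_2^2<\infty$ and $\mathbb{E}|\nabla_i g_i(Y_\beta)|<\infty$ for $i=1,\dots,n$, where $Y_\beta\sim N(\theta,(1+\beta)\sigma^2I_n)$. Then $$\lim_{\alpha\to0}\mathrm{CB}^\infty_\alpha(g)=\|Y-g(Y)\|_2^2+2\sigma^2(\nabla\cdot g)(Y)-n\sigma^2=\mathrm{SURE}(g)\quad\text{almost surely},$$ and consequently this limit is unbiased for $\mathrm{Risk}(g)=\mathbb{E}\|\theta-g(Y)\|_2^2$.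
   Context: Infinite-bootstrap CB estimator: with $\omega\sim N(0,\sigma^2I_n)$ independent of $Y$, $Y^*=Y+\sqrt\alpha\,\omega$, $Y^\dagger=Y-\omega/\sqrt\alpha$, $$\mathrm{CB}^\infty_\alpha(g)=\mathbb{E}\big[\|Y^\dagger-g(Y^* )\|_2^2-\|\omega\|_2^2/\alpha\,\big|\,Y\big]-n\sigma^2,$$ equivalently $\mathrm{CB}^\infty_\alpha(g)=\mathbb{E}[\|Y-g(Y+\sqrt\alpha\omega)\|_2^2\mid Y]+\frac{2}{\sqrt\alpha}\mathbb{E}[\langle\omega,g(Y+\sqrt\alpha\omega)\rangle\mid Y]-n\sigma^2$. The divergence is $(\nabla\cdot g)=\sum_{i=1}^n\nabla_i g_i$, and $\mathrm{SURE}(g)=\|Y-g(Y)\|_2^2+2\sigma^2(\nabla\cdot g)(Y)-n\sigma^2$ (Stein's unbiased risk estimate). A function $f:\mathbb{R}^n\to\mathbb{R}$ is weakly differentiable with weak partials $\nabla_if$ if $\int f\,\nabla_i\phi=-\int\nabla_i f\,\phi$ for all compactly supported $C^1$ test functions $\phi$; $g$ is weakly differentiable if each component is. *)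

(* Defs.v *)
From HB Require Import structures.
From mathcomp Require Import all_boot all_order all_algebra.
From mathcomp Require Import all_classical all_reals all_analysis.
Set Implicit Arguments. Unset Strict Implicit. Unset Printing Implicit Defensive.
Import Order.TTheory GRing.Theory Num.Theory.
Import numFieldNormedType.Exports.
Local Open Scope classical_set_scope.
Local Open Scope ring_scope.

Definition rV_measure_display : measure_display -> measure_display.
Proof. exact. Qed.

Section rV_measurable.
Context {R : realType} (n : nat).
Let coord : 'I_n -> 'rV[R]_n -> R := fun i x => x ord0 i.
Let s0 : g_sigma_preimage coord set0.
Proof. exact: sigma_algebra0. Qed.
Let sC A : g_sigma_preimage coord A -> g_sigma_preimage coord (~` A).
Proof. exact: sigma_algebraC. Qed.
Let sU (F : _^nat) : (forall i, g_sigma_preimage coord (F i)) ->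
  g_sigma_preimage coord (\bigcup_i (F i)).
Proof. exact: sigma_algebra_bigcup. Qed.
HB.instance Definition _ := @isMeasurable.Build (rV_measure_display default_measure_display)
  'rV[R]_n (g_sigma_preimage coord) s0 sC sU.
End rV_measurable.

Section defs.
Context {R : realType} {n : nat}.
Local Notation vec := 'rV[R]_n.

Definition sqnorm (x : vec) : R := \sum_(i < n) x ord0 i ^+ 2.
Definition dotp (x y : vec) : R := \sum_(i < n) x ord0 i * y ord0 i.

Definition is_lebesgue_rV (lam : {measure set vec -> \bar R}) : Prop :=
  forall a b : 'I_n -> R, (forall i, a i <= b i) ->
    lam [set x | forall i, a i < x ord0 i <= b i] = (\prod_(i < n) (b i - a i))%:E.

Definition is_normal_rV (mu : probability vec R) (m : vec) (s : R) : Prop :=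
  forall A : 'I_n -> set R, (forall i, measurable (A i)) ->
    mu [set x | forall i, A i (x ord0 i)] =
    (\prod_(i < n) fine (normal_prob (m ord0 i) s (A i)))%:E.

Definition test_fun (phi : vec -> R) : Prop :=
  compact (closure [set x | phi x != 0]) /\
  forall j : 'I_n, (forall x, derivable phi x (delta_mx 0 j)) /\
                   continuous (fun x => 'D_(delta_mx 0 j) phi x).

Definition weak_partial (lam : {measure set vec -> \bar R}) (j : 'I_n)
    (f v : vec -> R) : Prop :=
  (forall K : set vec, compact K ->
     lam.-integrable K (EFin \o f) /\ lam.-integrable K (EFin \o v)) /\
  forall phi, test_fun phi ->
    (\int[lam]_x (f x * 'D_(delta_mx 0 j) phi x)%:E =
     - \int[lam]_x (v x * phi x)%:E)%E.

Definition weakly_diff (lam : {measure set vec -> \bar R}) (f : vec -> R) : Prop :=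
  forall j : 'I_n, exists v, weak_partial lam j f v.

(** infinite-bootstrap CB estimator at Y = y; E[. | Y = y] is the integral
    over omega ~ N(0, s^2 I_n) = mu0, omega being independent of Y *)
Definition CB_inf (mu0 : probability vec R) (s : R) (g : vec -> vec)
    (a : R) (y : vec) : \bar R :=
  (\int[mu0]_w (sqnorm (y - (Num.sqrt a)^-1 *: w - g (y + Num.sqrt a *: w))
                - sqnorm w / a)%:E
   - (n%:R * s ^+ 2)%:E)%E.

Definition SURE (s : R) (g : vec -> vec) (dg : 'I_n -> vec -> R) (y : vec) : R :=
  sqnorm (y - g y) + 2 * s ^+ 2 * (\sum_(i < n) dg i y) - n%:R * s ^+ 2.

End defs.

(* Main.v *)
Require Import Defs.
From HB Require Import structures.
From mathcomp Require Import all_boot all_order all_algebra.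
From mathcomp Require Import all_classical all_reals all_analysis.
From mathcomp Require Import measurable_realfun ring lra.
Set Implicit Arguments.
Unset Strict Implicit.
Unset Printing Implicit Defensive.
Import Order.TTheory GRing.Theory Num.Theory.
Import numFieldNormedType.Exports.
Local Open Scope classical_set_scope.
Local Open Scope ring_scope.

(** Write [gexp y s f] for the expectation of [f] under N(y, s^2 I).  Substituting
    x = y + sqrt(a) w in the definition of the estimator cancels the term |w|^2 / a and
    leaves, with s = sqrt(a) sigma, expectations of g_i, g_i^2 and (x_i - y_i) g_i under
    N(y, s^2 I).  Stein's identity, obtained by testing the weak derivative against the
    Gaussian density multiplied by compactly supported C^1 cutoffs, turns the last one into
    s^2 gexp y s (d_i g_i), so the factor 2 / a in front of it is absorbed.  It remains
    that gexp y s f -> f y as s -> 0 for almost every y and every f integrable for a wider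
    Gaussian N(c, b^2 I): small Gaussian averages of f around y are bounded by the
    Hardy-Littlewood maximal function of |f| times the density of N(c, b^2 I), so by the
    weak-type (1,1) inequality the class of such f is closed under L^1 limits; it
    contains the indicators of orthants, hence all integrable functions.  Unbiasedness is
    Stein's identity at (theta, sigma) together with the first two Gaussian moments. *)

(** * Measures with a density *)

(** [lam] is known only through its values on boxes, so each fact about it (integrals of products,
    affine changes of variables, densities of normal laws) is obtained by checking a candidate
    measure on intervals or rectangles. The inflated variance enters through domination: a Gaussian
    of width [s < b], whatever its center, has density at most a constant times that of N(c, b^2 I),
    so integrability at one center and one width yields it at every center and every smaller width.
    That constant grows like [s^-n], hence says nothing about the limit [s -> 0]; this is the task
    of the maximal inequality. A function integrable for N(c, b^2 I) need not be Lebesgue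
    integrable, so the inequality is applied to [f * gauss c b], and half of the exponent of the
    narrow Gaussian pays for the division by [gauss c b]. *)

Section density.
Context {d : measure_display} {T : measurableType d} {R : realType}.
Local Open Scope ereal_scope.
Variables (mu : {measure set T -> \bar R}) (p : T -> R).
Hypotheses (p0 : forall x, (0 <= p x)%R) (mp : measurable_fun setT p).

(** The two hypotheses are arguments, so that the measure structure declared below can be recovered
    from the term itself. *)
Definition density_measure of (forall x, (0 <= p x)%R) & measurable_fun setT p :=
  fun A => \int[mu]_(x in A) (p x)%:E.

Let dens := density_measure p0 mp.

Let dens0 : dens set0 = 0.
Proof. exact: integral_set0. Qed.

Let dens_ge0 A : 0 <= dens A.
Proof. by apply: integral_ge0 => x _; rewrite lee_fin. Qed.

Let dens_sigma_additive : semi_sigma_additive dens.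
Proof.
by apply: semi_sigma_additive_nng_induced => //; exact/measurable_EFinP.
Qed.

HB.instance Definition _ :=
  isMeasure.Build d T R (density_measure p0 mp) dens0 dens_ge0 dens_sigma_additive.

End density.
Arguments density_measure {d T R} mu {p} p0 mp.

Section density_integral.
Context {d : measure_display} {T : measurableType d} {R : realType}.
Local Open Scope ereal_scope.
Variables (mu nu : {measure set T -> \bar R}) (p : T -> R).
Hypotheses (p0 : forall x, (0 <= p x)%R) (mp : measurable_fun setT p).
Hypothesis nuE : forall A, measurable A -> nu A = \int[mu]_(x in A) (p x)%:E.

Import HBNNSimple.

(** Both sides are limits along simple functions increasing to [f], by monotone convergence. For a
    simple function the identity splits over level sets, where it is the hypothesis [nuE]. *)
Lemma ge0_integral_density (f : T -> \bar R) :
  measurable_fun setT f -> (forall x, 0 <= f x) ->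
  \int[nu]_x f x = \int[mu]_x (f x * (p x)%:E).
Proof.
move=> mf f0; have mE : measurable [set: T] by [].
pose h := nnsfun_approx mE mf.
have mpE : measurable_fun setT (EFin \o p) by exact/measurable_EFinP.
have -> : \int[nu]_x f x = lim (\int[nu]_x (EFin \o h n) x @[n --> \oo]).
  under eq_integral.
    move=> x _.
    rewrite -(cvg_lim _ (cvg_nnsfun_approx mE mf (fun x _ => f0 x) (I : setT x)))//.
    over.
  apply: monotone_convergence => //.
  - by move=> n; apply/measurable_EFinP.
  - by move=> n x _; rewrite lee_fin.
  - by move=> x _ a b ab; rewrite lee_fin; exact/lefP/nd_nnsfun_approx.
have -> : \int[mu]_x (f x * (p x)%:E) =
    lim (\int[mu]_x ((EFin \o h n) x * (p x)%:E) @[n --> \oo]).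
  have fp x : f x * (p x)%:E = lim ((EFin \o h n) x * (p x)%:E @[n --> \oo]).
    apply/esym/cvg_lim => //; apply: cvgeZr => //.
    exact: (cvg_nnsfun_approx mE mf (fun x _ => f0 x) (I : setT x)).
  under eq_integral do rewrite fp.
  apply: monotone_convergence => //.
  - by move=> n; apply: emeasurable_funM => //; apply/measurable_EFinP.
  - by move=> n x _; rewrite mule_ge0 ?lee_fin.
  - move=> x _ a b ab; rewrite lee_wpmul2r ?lee_fin//.
    exact/lefP/nd_nnsfun_approx.
suff suf n : \int[mu]_x ((EFin \o h n) x * (p x)%:E) = \int[nu]_x (EFin \o h n) x.
  by under eq_fun do rewrite -suf.
have indich r : measurable_fun setT (fun x => (r * \1_(h n @^-1` [set r]) x)%:E).
  by apply/measurable_EFinP; exact: measurable_funM.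
transitivity (\int[nu]_x
   (\sum_(y \in range (h n)) (y * \1_(h n @^-1` [set y]) x)%:E)); last first.
  by apply: eq_integral => t tE; rewrite /= fimfunE -fsumEFin.
rewrite ge0_integral_fsum//; last by move=> m y Ey; exact: nnfun_muleindic_ge0.
transitivity (\int[mu]_x (\sum_(y \in range (h n))
    (y * \1_(h n @^-1` [set y]) x)%:E * (p x)%:E)).
  apply: eq_integral => x _.
  rewrite -ge0_mule_fsuml => [|y]; last exact: nnfun_muleindic_ge0.
  by rewrite fsumEFin //= [in LHS]fimfunE.
rewrite ge0_integral_fsum//; last 2 first.
  - by move=> y; exact: emeasurable_funM.
  - by move=> m y Ey; apply: mule_ge0; [exact: nnfun_muleindic_ge0|rewrite lee_fin].
apply: eq_fsbigr => r rhn.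
rewrite integralZl_indic_nnsfun// integral_indic// setIT.
have [r0|r0] := ltP r 0%R.
  rewrite preimage_nnfun0// measure0 mule0.
  by rewrite integral0_eq// => x _; rewrite indic0 mulr0 mul0e.
have mpA : measurable_fun setT ((EFin \o p) \_ (h n @^-1` [set r])).
  by apply/(measurable_restrictT _ _).1 => //; exact: measurable_funTS.
rewrite nuE// [in RHS]integral_mkcond -ge0_integralZl_EFin//; last first.
  by move=> x _; rewrite erestrict_ge0// => y _; rewrite lee_fin.
apply: eq_integral => x _; rewrite /patch indicE.
by case: ifP => /=; rewrite ?mulr1 ?mulr0 ?mul0e ?mule0.
Qed.

Lemma integrable_density (f : T -> R) : measurable_fun setT f ->
  nu.-integrable setT (EFin \o f) <->
  mu.-integrable setT (EFin \o (fun x => f x * p x)%R).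
Proof.
move=> mf.
have E : \int[nu]_x `|(f x)%:E| = \int[mu]_x `|(f x * p x)%:E|.
  rewrite ge0_integral_density//; last first.
    by apply: measurableT_comp => //; exact/measurable_EFinP.
  by apply: eq_integral => x _; rewrite EFinM abseM (@gee0_abs _ (p x)%:E)// lee_fin.
split=> /integrableP[_ H]; apply/integrableP; split.
- by apply/measurable_EFinP; exact: measurable_funM.
- by move: H; rewrite E.
- exact/measurable_EFinP.
- by move: H; rewrite -E.
Qed.

(** Multiplication by the nonnegative [p] commutes with taking positive and negative parts, so the
    nonnegative case applies to each part. *)
Lemma integral_density (f : T -> R) : measurable_fun setT f ->
  \int[nu]_x (f x)%:E = \int[mu]_x (f x * p x)%:E.
Proof.
move=> mf; rewrite integralE [RHS]integralE.
have mfE : measurable_fun setT (EFin \o f) by exact/measurable_EFinP.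
rewrite ge0_integral_density//; last exact: measurable_funepos.
rewrite ge0_integral_density//; last exact: measurable_funeneg.
congr (_ - _); apply: eq_integral => x _.
- by rewrite !funeposE/= -!EFin_max -EFinM maxr_pMl// mul0r.
- by rewrite !funenegE/= -!EFin_max -EFinM maxr_pMl// mul0r mulNr.
Qed.

End density_integral.

Lemma ge0_integral_density_measure {d : measure_display} {T : measurableType d}
    {R : realType} (mu : {measure set T -> \bar R}) (p : T -> R)
    (p0 : forall x, 0 <= p x) (mp : measurable_fun setT p) (f : T -> \bar R) :
  measurable_fun setT f -> (forall x, (0 <= f x)%E) ->
  (\int[density_measure mu p0 mp]_x f x = \int[mu]_x (f x * (p x)%:E))%E.
Proof. exact: (ge0_integral_density p0 mp (nu := density_measure mu p0 mp)). Qed.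

(** * Lebesgue measure on row vectors *)

Section rV_measure.
Context {R : realType} {n : nat}.
Local Notation vec := 'rV[R]_n.

Lemma measurable_coord (i : 'I_n) : measurable_fun setT (fun x : vec => x ord0 i).
Proof.
move=> _ Y mY; rewrite setTI; apply: sub_sigma_algebra => /=.
rewrite -bigcup_seq/=; exists i => /=; first by rewrite mem_index_enum.
by exists Y => //; rewrite setTI.
Qed.

Definition rect (A : 'I_n -> set R) : set vec := [set x | forall i, A i (x ord0 i)].

Lemma rectI A B : rect A `&` rect B = rect (fun i => A i `&` B i).
Proof.
apply/seteqP; split => x /=; first by move=> [Ax Bx] i.
by move=> AB; split=> i; have [] := AB i.
Qed.

Lemma measurable_rect A : (forall i, measurable (A i)) -> measurable (rect A).
Proof.
move=> mA; have -> : rect A = \big[setI/setT]_(i < n) (fun x : vec => x ord0 i) @^-1` A i.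
  rewrite -bigcap_seq; apply/seteqP; split => x /= H i; first by move=> _; exact: H.
  by apply: (H i); rewrite /= mem_index_enum.
apply: bigsetI_measurable => i _; rewrite -[X in measurable X]setTI.
exact: measurable_coord.
Qed.

Local Notation leb := (@lebesgue_measure R).

(** Sides of finite length keep the measure a product of real numbers, and the class is still stable
    under intersection. *)
Definition finite_rect : set (set vec) :=
  [set rect A | A in [set A | forall i, measurable (A i) /\ (leb (A i) < +oo)%E]].

(** Half-open like the boxes on which [is_lebesgue_rV] prescribes the measure; [r] is half the
    side. *)
Definition cube (y : vec) (r : R) : set vec :=
  rect (fun i => `]y ord0 i - r, y ord0 i + r]%classic).

Lemma finite_rect_cube y r : finite_rect (cube y r).
Proof.
exists (fun i => `]y ord0 i - r, y ord0 i + r]%classic) => // i; split => //.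
by rewrite lebesgue_measure_itv/=; case: ifP; rewrite ltry.
Qed.

Lemma bigcup_cube : \bigcup_k cube 0 k%:R = setT.
Proof.
apply/seteqP; split => // x _.
pose M := \sum_(i < n) `|x ord0 i|.
have [k Mk] : exists k : nat, M < k%:R.
  by exists (Num.truncn M).+1; rewrite truncnS_gt.
exists k => // i /=; rewrite mxE sub0r add0r in_itv/=.
have : `|x ord0 i| < k%:R.
  by rewrite (le_lt_trans _ Mk)// /M (bigD1 i)//= lerDl sumr_ge0.
by rewrite ltr_norml => /andP[-> /ltW ->].
Qed.

(** A cylinder over one coordinate has infinite sides, but truncating every side to []-k, k]] writes
    it as a countable union of finite rectangles. *)
Lemma measurable_rVE : @measurable _ vec = <<s finite_rect >>.
Proof.
apply/seteqP; split; last first.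
  apply: smallest_sub; first exact: sigma_algebra_measurable.
  by move=> _ [A mA <-]; apply: measurable_rect => i; exact: (mA i).1.
apply: smallest_sub; first exact: smallest_sigma_algebra.
rewrite -bigcup_seq; apply: bigcup_sub => i _ _ [A mA <-]; rewrite setTI.
pose B k j := (if j == i then A else setT) `&` `]- k%:R, k%:R]%classic : set R.
have -> : (fun x : vec => x ord0 i) @^-1` A = \bigcup_k rect (B k).
  apply/seteqP; split => x /= => [Ax|[k _ /(_ i)[]]]; last by rewrite eqxx.
  have : (\bigcup_k cube 0 k%:R) x by rewrite bigcup_cube.
  move=> [k _ xk]; exists k => // j; split; first by case: eqP => // ->.
  by have := xk j; rewrite mxE sub0r add0r.
apply: sigma_algebra_bigcup => k; apply: sub_sigma_algebra.
exists (B k) => // j; have mB : measurable (B k j).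
  by apply: measurableI => //; case: ifP.
split=> //; apply: (@le_lt_trans _ _ (leb `]- k%:R, k%:R]%classic)).
  by apply: le_measure; rewrite ?inE//; exact: subIsetr.
by rewrite lebesgue_measure_itv/=; case: ifP; rewrite ltry.
Qed.

Lemma measurable_fun_rV {d} {T : measurableType d} (f : T -> vec) :
  (forall i, measurable_fun setT (fun x => f x ord0 i)) -> measurable_fun setT f.
Proof.
move=> mf; apply: (@measurability _ _ _ _ _ _ finite_rect).
  exact: measurable_rVE.
move=> _ [_ [A mA <-] <-]; rewrite setTI.
have -> : f @^-1` rect A = \big[setI/setT]_(i < n) ((fun x => f x ord0 i) @^-1` A i).
  rewrite -bigcap_seq; apply/seteqP; split => x /= H i; first by move=> _; exact: H.
  by apply: (H i); rewrite /= mem_index_enum.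
apply: bigsetI_measurable => i _; rewrite -[X in measurable X]setTI.
by apply: mf => //; exact: (mA i).1.
Qed.

(** Finite rectangles form a generating pi-system, and the cubes [cube 0 k] exhaust the space with
    finite measure. *)
Lemma measure_rV_unique (m1 m2 : {measure set vec -> \bar R}) :
  (forall A, finite_rect A -> m1 A = m2 A) ->
  (forall k : nat, m1 (cube 0 k%:R) < +oo)%E ->
  forall A, measurable A -> m1 A = m2 A.
Proof.
move=> m12 m1oo; apply: (measure_unique finite_rect (fun k => cube 0 k%:R)) => //.
- exact: measurable_rVE.
- move=> _ _ [A mA <-] [B mB <-]; rewrite rectI.
  exists (fun i => A i `&` B i) => //; move=> i.
  have [[mAi Aoo] [mBi _]] := (mA i, mB i).
  split; first exact: measurableI.
  apply: le_lt_trans Aoo; apply: le_measure; rewrite ?inE//.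
  exact: measurableI.
- by move=> k; apply: finite_rect_cube.
- exact: bigcup_cube.
Qed.

End rV_measure.

(** * Integrals of products of one-variable functions *)

Section scaled_lebesgue.
Context {R : realType}.
Local Notation leb := (@lebesgue_measure R).

Lemma scaled_lebesgue_measure_unique (c : R)
    (m : {measure set (measurableTypeR R) -> \bar R}) : 0 <= c ->
  (forall a b : R, a <= b -> m `]a, b]%classic = ((b - a) * c)%:E) ->
  forall A, measurable A -> m A = (c%:E * leb A)%E.
Proof.
move=> c0 mE A mA; rewrite -[RHS]/(mscale (NngNum c0) leb A); apply/esym.
apply: (@measure_unique _ R (measurableTypeR R) (@ocitv R)
  (fun k : nat => `]- k%:R, k%:R]%classic) _ _ _ _ (mscale (NngNum c0) leb) m) => //.
- exact: ocitvI.
- by move=> k; exact: is_ocitv.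
- apply/seteqP; split => // x _; exists (Num.truncn `|x|).+1 => //=.
  have : `|x| < (Num.truncn `|x|).+1%:R by rewrite truncnS_gt.
  by rewrite in_itv/= ltr_norml => /andP[-> /ltW ->].
- move=> X /ocitvP[->|[[a b] /= ab ->]]; first by rewrite !measure0.
  rewrite /mscale/= lebesgue_measure_itv/= lte_fin ab mE ?(ltW ab)//.
  by rewrite -EFinB -EFinM mulrC.
- move=> k; change (c%:E * leb (`]- k%:R, k%:R]%classic)%R < +oo)%E.
  rewrite lebesgue_measure_itv/=.
  by case: ifP; rewrite ?mule0 ?ltry// -EFinB -EFinM ltry.
Qed.

End scaled_lebesgue.

Definition image_measure {d1 d2 : measure_display} {T1 : measurableType d1}
    {T2 : measurableType d2} {R : realType} (m : {measure set T1 -> \bar R})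
    (f : T1 -> T2) (mf : measurable_fun setT f) : {measure set T2 -> \bar R} :=
  measure_function_pushforward__canonical__measure_function_Measure m mf.

Section lebesgue_rV.
Context {R : realType} {n : nat}.
Local Notation vec := 'rV[R]_n.
Local Notation leb := (@lebesgue_measure R).
Variable lam : {measure set vec -> \bar R}.
Hypothesis lamP : is_lebesgue_rV lam.

Lemma lam_box (a b : 'I_n -> R) : (forall i, a i <= b i) ->
  lam (rect (fun i => `]a i, b i]%classic)) = (\prod_(i < n) (b i - a i))%:E.
Proof.
by move=> /lamP <-; congr (lam _).
Qed.

Lemma lam_cube (y : vec) (r : R) : 0 <= r -> lam (cube y r) = ((r *+ 2) ^+ n)%:E.
Proof.
move=> r0; rewrite lam_box => [|i]; last by lra.
rewrite (eq_bigr (fun=> r *+ 2)) ?prodr_const ?card_ord// => i _.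
by ring.
Qed.

Definition prod_fun (h : 'I_n -> R -> R) (x : vec) : R := \prod_(i < n) h i (x ord0 i).

Lemma measurable_prod_fun (h : 'I_n -> R -> R) :
  (forall i, measurable_fun setT (h i)) -> measurable_fun setT (prod_fun h).
Proof.
move=> mh; apply: measurable_prod => i _.
exact: (measurableT_comp (mh i) (measurable_coord i)).
Qed.

Lemma prod_fun_ge0 (h : 'I_n -> R -> R) : (forall i t, 0 <= h i t) -> forall x, 0 <= prod_fun h x.
Proof. by move=> h0 x; apply: prodr_ge0. Qed.

Let good (f : R -> R) := [/\ forall t, 0 <= f t, measurable_fun setT f
  & leb.-integrable setT (EFin \o f)].

Let I (f : R -> R) : R := fine (\int[leb]_t (f t)%:E)%E.

Let IE f : good f -> (\int[leb]_t (f t)%:E)%E = (I f)%:E.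
Proof. by case=> f0 mf intf; rewrite fineK// integrable_fin_num. Qed.

Let I_ge0 f : good f -> 0 <= I f.
Proof. by case=> f0 _ _; apply/fine_ge0/integral_ge0 => t _; rewrite lee_fin. Qed.

Let ocind (ab : R * R) : R -> R := \1_(`]ab.1, ab.2]%classic).

Let good_ocind ab : good (ocind ab).
Proof.
split=> [t||]; rewrite /ocind; [by []|exact: measurable_indic|].
exact: integrable_indic_itv.
Qed.

Let I_ocind ab : ab.1 <= ab.2 -> I (ocind ab) = ab.2 - ab.1.
Proof.
move=> ab12; rewrite /I integral_indic//= setIT lebesgue_measure_itv/= lte_fin.
case: ltP => //= ba; apply/eqP; rewrite eq_sym subr_eq0 eq_le ab12.
by rewrite (le_trans ba).
Qed.

(* The factors are treated one coordinate at a time: with the others fixed, the image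
   of the weighted measure under that coordinate is a multiple of the Lebesgue measure
   on the line, because it is so on bounded intervals. *)
Lemma integral_prod_fun (h : 'I_n -> R -> R) : (forall i, good (h i)) ->
  (\int[lam]_x (prod_fun h x)%:E)%E = (\prod_(i < n) I (h i))%:E.
Proof.
(* Induction on the number [k] of leading factors that are arbitrary, the others being indicators of
   intervals: at [k = 0] the product is the indicator of a box, at [k = n] nothing is assumed of the
   factors. *)
suff P k : forall h, (forall i, good (h i)) ->
    (forall i : 'I_n, (k <= i)%N -> exists2 ab, h i = ocind ab & ab.1 <= ab.2) ->
    (\int[lam]_x (prod_fun h x)%:E)%E = (\prod_(i < n) I (h i))%:E.
  by move=> gh; apply: (P n) => // i; rewrite leqNgt ltn_ord.
elim: k => [|k IH] {}h gh hk.
  have /choice[ab abP] : forall i, exists ab, h i = ocind ab /\ ab.1 <= ab.2.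
    by move=> i; have [ab ? ?] := hk i (leq0n _); exists ab.
  transitivity (\int[lam]_x (\1_(rect (fun i => `](ab i).1, (ab i).2]%classic)) x)%:E)%E.
    apply: eq_integral => x _; congr EFin; rewrite /prod_fun indicE.
    under eq_bigr do rewrite (abP _).1 /ocind indicE.
    case: (boolP (x \in _)); rewrite ?inE => xP.
      rewrite big1// => i _; rewrite mem_set//; exact: xP.
    have /existsNP[i xi] : ~ rect (fun i => `](ab i).1, (ab i).2]%classic) x.
      by move=> H; move: xP; rewrite mem_set.
    by rewrite (bigD1 i)//= memNset// mul0r.
  rewrite integral_indic//; last by apply: measurable_rect.
  rewrite setIT lam_box => [|i]; last by case: (abP i).
  by congr EFin; apply: eq_bigr => i _; rewrite (abP i).1 I_ocind// (abP i).2.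
have [kn|nk] := ltnP k n; last first.
  by apply: IH => // i /(leq_trans nk); rewrite leqNgt ltn_ord.
pose i0 := Ordinal kn.
pose upd f j := if j == i0 then f else h j.
have gupd f : good f -> forall j, good (upd f j) by move=> gf j; rewrite /upd; case: ifP.
pose p := prod_fun (upd (cst 1)).
pose c := \prod_(j < n | j != i0) I (h j).
have c0 : 0 <= c by apply: prodr_ge0 => j _; exact: I_ge0.
have p0 x : 0 <= p x.
  by apply: prod_fun_ge0 => j t; rewrite /upd; case: ifP => // _; case: (gh j).
have mp : measurable_fun setT p.
  apply: measurable_prod_fun => j; rewrite /upd; case: ifP => _; first exact: measurable_cst.
  by case: (gh j).
have updE f x : prod_fun (upd f) x = f (x ord0 i0) * p x.
  rewrite /p /prod_fun (bigD1 i0)//= [in RHS](bigD1 i0)//= /upd eqxx mul1r.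
  by congr (_ * _); apply: eq_bigr => j /negbTE ->.
have IupdE f : \prod_(i < n) I (upd f i) = I f * c.
  rewrite (bigD1 i0)//= /upd eqxx; congr (_ * _).
  by apply: eq_bigr => j /negbTE ->.
have hE : h = upd (h i0).
  by apply/funext => j; rewrite /upd; case: eqP => // ->.
pose m := image_measure (T2 := measurableTypeR R) (density_measure lam p0 mp) (measurable_coord i0).
have mE (f : R -> R) : (forall t, 0 <= f t) -> measurable_fun setT f ->
    (\int[m]_t (f t)%:E = \int[lam]_x (prod_fun (upd f) x)%:E)%E.
  move=> f0 mf; have mfE : measurable_fun setT (EFin \o f) by exact/measurable_EFinP.
  transitivity (\int[density_measure lam p0 mp]_x (f (x ord0 i0))%:E)%E.
    have := @ge0_integral_pushforward _ _ _ (measurableTypeR R) R _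
      (measurable_coord i0) (density_measure lam p0 mp) setT (EFin \o f).
    rewrite preimage_setT; apply => // t _; by rewrite /= lee_fin.
  rewrite ge0_integral_density_measure//=.
  - by apply: eq_integral => x _; rewrite updE EFinM.
  - exact: (measurableT_comp mfE (measurable_coord i0)).
  - by move=> x; rewrite lee_fin.
have mleb A : measurable A -> m A = (c%:E * leb A)%E.
  move=> mA; apply: (scaled_lebesgue_measure_unique c0) => // a b ab.
  have gab := good_ocind (a, b).
  transitivity (\int[m]_t (ocind (a, b) t)%:E)%E.
    by rewrite integral_indic//= setIT.
  have [ab0 mab _] := gab.
  rewrite mE// IH; last 2 first.
  - exact: gupd.
  - move=> i ki; rewrite /upd; case: eqP => [_|/eqP ii0]; first by exists (a, b).
    by apply: hk; rewrite ltn_neqAle ki andbT eq_sym; apply: contra ii0 => /eqP ik; apply/eqP/val_inj.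
  by rewrite IupdE I_ocind.
have [h0 mh _] := gh i0.
have mhE : measurable_fun setT (EFin \o h i0) by exact/measurable_EFinP.
rewrite hE -mE//.
have mE' A : measurable A -> m A = (\int[leb]_(t in A) (cst c t)%:E)%E.
  by move=> mA; rewrite mleb// -integral_cst.
rewrite (ge0_integral_density (mu := leb) (p := cst c) _ _ mE')//=.
rewrite ge0_integralZr//; last by move=> t _; rewrite lee_fin.
by rewrite IE// IupdE.
Qed.

End lebesgue_rV.

(** * Gaussian densities and moments *)

Section sqnorm_facts.
Context {R : realType} {n : nat}.
Local Notation vec := 'rV[R]_n.

Lemma sqnorm_ge0 (x : vec) : 0 <= sqnorm x.
Proof. by apply: sumr_ge0 => i _; exact: sqr_ge0. Qed.

Lemma coord_sqr_le (x : vec) i : x ord0 i ^+ 2 <= sqnorm x.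
Proof. by rewrite /sqnorm (bigD1 i)//= lerDl sumr_ge0// => j _; exact: sqr_ge0. Qed.

Lemma measurable_sqnormB (m : vec) : measurable_fun setT (fun x : vec => sqnorm (x - m)).
Proof.
apply: measurable_sum => i; apply: (@measurable_funX _ _ _ _ (fun x : vec => (x - m) ord0 i)).
under eq_fun do rewrite !mxE.
by apply: measurable_funB => //; exact: measurable_coord.
Qed.

(* Weighted Cauchy-Schwarz: [(u + v)^2 <= u^2 / t + v^2 / (1 - t)]. *)
Lemma sqnorm_recenter (t : R) (m c x : vec) : 0 < t -> t < 1 ->
  sqnorm (x - c) <= sqnorm (x - m) / t + sqnorm (m - c) / (1 - t).
Proof.
move=> t0 t1; rewrite /sqnorm !mulr_suml -big_split/=; apply: ler_sum => i _.
rewrite !mxE; set a := x ord0 i; set b := m ord0 i; set d := c ord0 i.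
have t1' : 0 < 1 - t by lra.
rewrite -subr_ge0.
have -> : (a - b) ^+ 2 / t + (b - d) ^+ 2 / (1 - t) - (a - d) ^+ 2 =
  ((1 - t) * (a - b) - t * (b - d)) ^+ 2 / (t * (1 - t)).
  by field; rewrite !gt_eqF.
by rewrite divr_ge0 ?sqr_ge0// mulr_ge0// ltW.
Qed.

End sqnorm_facts.

Section gauss_kernel.
Context {R : realType} {n : nat}.
Local Notation vec := 'rV[R]_n.
Local Notation leb := (@lebesgue_measure R).

Definition gauss (m : vec) (s : R) (x : vec) : R :=
  normal_peak s ^+ n * expR (- sqnorm (x - m) / (s ^+ 2 *+ 2)).

Lemma gauss_ge0 m s x : 0 <= gauss m s x.
Proof. by rewrite mulr_ge0 ?expR_ge0// exprn_ge0// normal_peak_ge0. Qed.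

Lemma gauss_gt0 m s x : 0 < s -> 0 < gauss m s x.
Proof. by move=> s0; rewrite mulr_gt0 ?expR_gt0// exprn_gt0// normal_peak_gt0// gt_eqF. Qed.

Lemma measurable_gauss m s : measurable_fun setT (gauss m s).
Proof.
apply: measurable_funM => //; apply: (measurableT_comp (@measurable_expR R)).
apply: measurable_funM => //; apply: measurableT_comp => //; exact: measurable_sqnormB.
Qed.

Lemma gaussE m s : s != 0 -> gauss m s = prod_fun (fun i => normal_pdf (m ord0 i) s).
Proof.
move=> s0; apply/funext => x; rewrite /gauss /prod_fun.
under eq_bigr do rewrite normal_pdfE//.
rewrite big_split/= prodr_const card_ord; congr (_ * _).
rewrite /normal_fun -expR_sum; congr expR.
by rewrite /sqnorm -sumrN mulr_suml; apply: eq_bigr => i _; rewrite !mxE.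
Qed.

Lemma normal_peak_scale (c s : R) : 0 < c -> normal_peak (c * s) = c^-1 * normal_peak s.
Proof.
move=> c0; rewrite /normal_peak exprMn -mulrA -mulrnAr sqrtrM ?sqr_ge0//.
by rewrite sqrtr_sqr gtr0_norm// invfM.
Qed.

(** The factor [c ^+ n] is the Jacobian of [w |-> y + c w]. *)
Lemma gauss_affine (y w : vec) (c s : R) : 0 < c -> 0 < s ->
  gauss 0 s w = c ^+ n * gauss y (c * s) (y + c *: w).
Proof.
move=> c0 s0; rewrite /gauss normal_peak_scale//.
have -> : (c^-1 * normal_peak s) ^+ n = c ^- n * normal_peak s ^+ n by rewrite exprMn exprVn.
rewrite !mulrA divff ?mul1r; last by rewrite expf_neq0// gt_eqF.
congr (_ * expR _).
have -> : sqnorm (y + c *: w - y) = c ^+ 2 * sqnorm (w - 0).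
  by rewrite addrAC subrr add0r subr0 /sqnorm mulr_sumr; apply: eq_bigr => i _; rewrite mxE exprMn.
by rewrite exprMn; field; rewrite !gt_eqF.
Qed.

End gauss_kernel.

Section lebesgue_gauss.
Context {R : realType} {n : nat}.
Local Notation vec := 'rV[R]_n.
Local Notation leb := (@lebesgue_measure R).
Variable lam : {measure set vec -> \bar R}.
Hypothesis lamP : is_lebesgue_rV lam.

(** Multiplying each [h i] by the indicator of [A i] turns the rectangle into the whole space, so
    [h i] is asked to be integrable over [A i] only. This allows constant factors, which give the
    volume of a rectangle. *)
Lemma integral_rect_prod_fun (h : 'I_n -> R -> R) (A : 'I_n -> set R) :
  (forall i t, 0 <= h i t) -> (forall i, measurable_fun setT (h i)) ->
  (forall i, measurable (A i)) ->
  (forall i, \int[leb]_(t in A i) (h i t)%:E < +oo)%E ->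
  (\int[lam]_(x in rect A) (prod_fun h x)%:E =
   (\prod_(i < n) fine (\int[leb]_(t in A i) (h i t)%:E)%E)%:E)%E.
Proof.
move=> h0 mh mA hoo; pose hA i t := h i t * \1_(A i) t.
have hAE i : (\int[leb]_t (hA i t)%:E = \int[leb]_(t in A i) (h i t)%:E)%E.
  by rewrite [RHS]integral_mkcond; apply: eq_integral => t _; rewrite patchE /hA indicE; case: ifP => _; rewrite ?mulr1 ?mulr0.
have hA0 i t : 0 <= hA i t by rewrite mulr_ge0.
have mhA i : measurable_fun setT (hA i) by apply: measurable_funM.
rewrite integral_mkcond.
under eq_bigr do rewrite -hAE.
rewrite -(integral_prod_fun lamP); last first.
  move=> i; split=> //; apply/integrableP; split; first by apply/measurable_EFinP; exact: mhA.
  by under eq_integral do rewrite gee0_abs ?lee_fin//; rewrite hAE.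
apply: eq_integral => x _; rewrite patchE /prod_fun.
case: ifPn => [/set_mem xA|xA].
  by congr EFin; apply: eq_bigr => i _; rewrite /hA indicE mem_set ?mulr1.
have /existsNP[i xi] : ~ rect A x by move=> H; move: xA; rewrite mem_set.
by rewrite (bigD1 i)//= /hA indicE memNset// mulr0 mul0r.
Qed.

Lemma integral_gauss_rect (m : vec) (s : R) (A : 'I_n -> set R) : 0 < s ->
  (forall i, measurable (A i)) ->
  (\int[lam]_(x in rect A) (gauss m s x)%:E =
   (\prod_(i < n) fine (normal_prob (m ord0 i) s (A i)))%:E)%E.
Proof.
move=> s0 mA; rewrite gaussE ?gt_eqF// integral_rect_prod_fun//.
- by move=> i t; exact: normal_pdf_ge0.
- by move=> i; exact: measurable_normal_pdf.
- move=> i; apply: integrable_lty.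
    exact: mA.
  by apply: (@integrableS _ _ _ _ setT); [by []|exact: mA|by []|exact: integrable_normal_pdf].
Qed.

Lemma integral_gauss (m : vec) (s : R) : 0 < s -> (\int[lam]_x (gauss m s x)%:E = 1)%E.
Proof.
move=> s0; have -> : [set: vec] = rect (fun=> setT) by apply/seteqP; split.
rewrite integral_gauss_rect// big1// => i _.
by rewrite (@probability_setT _ _ _ (normal_prob (m ord0 i) s)).
Qed.

(** The law and the measure with density [gauss m s] agree on rectangles, where both are products of
    one-dimensional normal probabilities. *)
Lemma normal_density (mu : probability vec R) (m : vec) (s : R) : 0 < s ->
  is_normal_rV mu m s ->
  forall A, measurable A -> mu A = (\int[lam]_(x in A) (gauss m s x)%:E)%E.
Proof.
move=> s0 muP A mA.
apply: (@measure_rV_unique _ _ mu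
  (density_measure lam (gauss_ge0 m s) (measurable_gauss m s))) => //.
- move=> _ [B mB <-]; have mB' i : measurable (B i) by exact: (mB i).1.
  transitivity (\int[lam]_(x in rect B) (gauss m s x)%:E)%E => //.
  by rewrite integral_gauss_rect// -(muP _ mB').
- by move=> k; rewrite (le_lt_trans (probability_le1 _ _)) ?ltry//; exact: measurable_rect.
Qed.

Lemma lam_rect (A : 'I_n -> set R) : (forall i, measurable (A i)) ->
  (forall i, leb (A i) < +oo)%E ->
  lam (rect A) = (\prod_(i < n) fine (leb (A i)))%:E.
Proof.
move=> mA Aoo.
transitivity (\int[lam]_(x in rect A) (prod_fun (fun _ => cst 1) x)%:E)%E.
  under eq_integral do rewrite /prod_fun big1//.
  by rewrite integral_cst ?mul1e//; exact: measurable_rect.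
have lE i : (\int[leb]_(t in A i) (cst (1 : R) t)%:E = leb (A i))%E.
  rewrite -[LHS]/(\int[leb]_(t in A i) cst 1%:E t)%E integral_cst ?mul1e//; exact: mA.
rewrite integral_rect_prod_fun//; last by move=> i; rewrite lE.
by congr EFin; apply: eq_bigr => i _; rewrite lE.
Qed.

End lebesgue_gauss.

(** * Affine images of Lebesgue and normal measures *)

Section affine.
Context {R : realType} {n : nat}.
Local Notation vec := 'rV[R]_n.

Lemma lebesgue_rV_unique (l1 l2 : {measure set vec -> \bar R}) :
  is_lebesgue_rV l1 -> is_lebesgue_rV l2 -> forall A, measurable A -> l1 A = l2 A.
Proof.
move=> l1P l2P; apply: measure_rV_unique => [_ [A mA <-]|k].
  by rewrite !lam_rect// => i; case: (mA i).
by rewrite (lam_cube l1P)// ltry.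
Qed.

Definition affine (y : vec) (c : R) (w : vec) : vec := y + c *: w.

Lemma measurable_affine (y : vec) (c : R) : measurable_fun setT (affine y c).
Proof.
apply: measurable_fun_rV => i; rewrite /affine; under eq_fun do rewrite !mxE.
apply: measurable_funD => //; apply: measurable_funM => //; exact: measurable_coord.
Qed.

Variables (lam : {measure set vec -> \bar R}) (lamP : is_lebesgue_rV lam).

(** The right-hand side, as a function of [A], is a measure with the prescribed values on boxes, so
    uniqueness identifies it with [lam]. *)
Lemma lebesgue_affine (y : vec) (c : R) (A : set vec) : 0 < c -> measurable A ->
  lam A = ((c ^+ n)%:E * lam (affine y c @^-1` A))%E.
Proof.
move=> c0 mA; have cn0 : 0 <= c ^+ n by rewrite exprn_ge0// ltW.
apply: (lebesgue_rV_unique lamP (l2 := mscale (NngNum cn0) (image_measure lam (measurable_affine y c)))) => //.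
move=> a b ab; rewrite /mscale/=.
pose f (u : 'I_n -> R) i := (u i - y ord0 i) / c.
have := @lam_box _ _ _ lamP (f a) (f b).
have -> : rect (fun i => `]f a i, f b i]%classic) =
    affine y c @^-1` rect (fun i => `]a i, b i]%classic).
  apply/seteqP; split => x H i; have := H i; rewrite /= !in_itv/= /affine !mxE /f ltr_pdivrMr// ler_pdivlMr//;
  by rewrite ltrBlDl lerBrDl (mulrC c).
move=> fE; transitivity ((c ^+ n)%:E * (\prod_(i < n) (f b i - f a i))%:E)%E.
  by rewrite -fE// => i; rewrite /f ler_pM2r ?invr_gt0// lerB.
rewrite -EFinM; congr EFin.
have -> : c ^+ n = \prod_(i < n) c by rewrite prodr_const card_ord.
rewrite -big_split/=; apply: eq_bigr => i _.
by rewrite /f; field; rewrite gt_eqF.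
Qed.

Lemma normal_affine_density (mu : probability vec R) (s c : R) (y : vec) :
  0 < s -> 0 < c -> is_normal_rV mu 0 s -> forall A, measurable A ->
  mu (affine y c @^-1` A) = (\int[lam]_(x in A) (gauss y (c * s) x)%:E)%E.
Proof.
move=> s0 c0 muP A mA; have ma := measurable_affine y c.
have mA' : measurable (affine y c @^-1` A).
  by rewrite -[X in measurable X]setTI; exact: ma.
rewrite (normal_density lamP s0 muP)//.
have cn0 : 0 <= c ^+ n by rewrite exprn_ge0// ltW.
(* Extending the density by zero outside [A] lets the change of variables be made over the whole
   space. *)
pose F x := ((gauss y (c * s)) \_ A) x.
have mF : measurable_fun setT F.
  by apply/(measurable_restrictT _ _).1 => //; apply: measurable_funTS; exact: measurable_gauss.
have F0 x : 0 <= F x by rewrite /F patchE; case: ifP => // _; exact: gauss_ge0.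
have -> : (\int[lam]_(x in A) (gauss y (c * s) x)%:E = \int[lam]_x (F x)%:E)%E.
  by rewrite integral_mkcond; apply: eq_integral => x _; rewrite /F !patchE; case: ifP.
pose m := mscale (NngNum cn0) (image_measure lam (measurable_affine y c)).
rewrite [RHS](@eq_measure_integral _ _ _ _ m lam); last first.
  by move=> B mB _; rewrite (lebesgue_affine y c0 mB).
have mFE : measurable_fun setT (EFin \o F) by exact/measurable_EFinP.
have F0E x : (0 <= (F x)%:E)%E by rewrite lee_fin.
rewrite [RHS]ge0_integral_mscale//.
rewrite [X in (_ * X)%E](@ge0_integral_pushforward _ _ _ _ _ _ (measurable_affine y c))//.
rewrite preimage_setT -ge0_integralZl//=; last first.
  exact: (measurableT_comp mFE (measurable_affine y c)).
rewrite [LHS]integral_mkcond; apply: eq_integral => w _.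
rewrite /F !patchE /=.
have -> : (w \in affine y c @^-1` A) = (y + c *: w \in A).
  by apply/idP/idP => /set_mem H; apply/mem_set.
by case: ifP => _; rewrite ?mule0// -EFinM -gauss_affine.
Qed.

End affine.

(** * Expectations under N(m, s^2 I) and their first two moments *)

Section gauss_expectation.
Context {R : realType} {n : nat}.
Local Notation vec := 'rV[R]_n.
Variables (lam : {measure set vec -> \bar R}) (lamP : is_lebesgue_rV lam).

(** Integrability under N(m, s^2 I) is expressed through [lam], so that Gaussians with different
    centers and widths are compared through their densities against one measure. *)
Definition gint (m : vec) (s : R) (f : vec -> R) : Prop :=
  measurable_fun setT f /\
  lam.-integrable setT (EFin \o (fun x => f x * gauss m s x)).

Definition gexp (m : vec) (s : R) (f : vec -> R) : R :=
  fine (\int[lam]_x (f x * gauss m s x)%:E)%E.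

Lemma gexpE m s f : gint m s f -> (\int[lam]_x (f x * gauss m s x)%:E = (gexp m s f)%:E)%E.
Proof. by case=> _ fi; rewrite fineK//; exact: integrable_fin_num. Qed.

Lemma gint_cst m s (c : R) : 0 < s -> gint m s (cst c).
Proof.
move=> s0; split; first exact: measurable_cst.
rewrite (_ : EFin \o _ = fun x => (c%:E * (gauss m s x)%:E)%E)//.
apply: integrableZl => //; apply/integrableP; split.
  by apply/measurable_EFinP; exact: measurable_gauss.
under eq_integral do rewrite gee0_abs ?lee_fin ?gauss_ge0//.
by rewrite (integral_gauss lamP)// ltry.
Qed.

Lemma gexp_cst m s (c : R) : 0 < s -> gexp m s (cst c) = c.
Proof.
move=> s0; rewrite /gexp; under eq_integral do rewrite EFinM.
have [_ gi] := gint_cst m 1 s0.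
rewrite integralZl//.
  by rewrite (integral_gauss lamP)// mule1.
by apply: eq_integrable gi => // x _ /=; rewrite mul1r.
Qed.

Lemma gintD m s f g : gint m s f -> gint m s g -> gint m s (fun x => f x + g x).
Proof.
move=> [mf fi] [mg gi]; split; first exact: measurable_funD.
have := integrableD measurableT fi gi.
by apply: eq_integrable => // x _; rewrite /= mulrDl.
Qed.

Lemma gexpD m s f g : gint m s f -> gint m s g ->
  gexp m s (fun x => f x + g x) = gexp m s f + gexp m s g.
Proof.
move=> fi gi; rewrite /gexp; under eq_integral do rewrite mulrDl EFinD.
by rewrite integralD//; [rewrite gexpE// (gexpE gi)|case: fi|case: gi].
Qed.

Lemma gintZ m s (k : R) f : gint m s f -> gint m s (fun x => k * f x).
Proof.
move=> [mf fi]; split; first exact: measurable_funM.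
have := integrableZl measurableT k fi.
by apply: eq_integrable => // x _; rewrite /= -mulrA.
Qed.

Lemma gexpZ m s (k : R) f : gint m s f -> gexp m s (fun x => k * f x) = k * gexp m s f.
Proof.
move=> fi; rewrite /gexp; under eq_integral do rewrite -mulrA EFinM.
by rewrite integralZl//; [rewrite gexpE//|case: fi].
Qed.

Lemma gint_sum m s (I : Type) (r : seq I) (f : I -> vec -> R) : 0 < s ->
  (forall i, gint m s (f i)) -> gint m s (fun x => \sum_(i <- r) f i x).
Proof.
move=> s0 fi; elim: r => [|i r IH].
  by under eq_fun do rewrite big_nil; exact: gint_cst.
by under eq_fun do rewrite big_cons; exact: gintD.
Qed.

Lemma gexp_sum m s (I : Type) (r : seq I) (f : I -> vec -> R) : 0 < s ->
  (forall i, gint m s (f i)) ->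
  gexp m s (fun x => \sum_(i <- r) f i x) = \sum_(i <- r) gexp m s (f i).
Proof.
move=> s0 fi; elim: r => [|i r IH].
  by under eq_fun do rewrite big_nil; rewrite big_nil (gexp_cst m 0).
under eq_fun do rewrite big_cons.
by rewrite big_cons gexpD ?IH//; exact: gint_sum.
Qed.

Lemma gint_le m s (f g : vec -> R) : measurable_fun setT f -> gint m s g ->
  (forall x, `|f x| <= `|g x|) -> gint m s f.
Proof.
move=> mf [mg gi] fg; split=> //; apply: le_integrable gi => //.
  by apply/measurable_EFinP; apply: measurable_funM => //; exact: measurable_gauss.
by move=> x _; rewrite /= lee_fin !normrM ler_pM.
Qed.

Lemma le_gexp m s f g : gint m s f -> gint m s g ->
  (forall x, f x <= g x) -> gexp m s f <= gexp m s g.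
Proof.
move=> fi gi fg; rewrite -lee_fin -!gexpE//; apply: le_integral => //; [by case: fi|by case: gi|].
by move=> x _; rewrite lee_fin ler_wpM2r// gauss_ge0.
Qed.

Lemma gint_dominated m s c b f C : (forall x, gauss m s x <= C * gauss c b x) ->
  gint c b f -> gint m s f.
Proof.
move=> dom fi; have [mf _] := fi; split=> //.
have [_ Cfi] := gintZ C fi; apply: le_integrable Cfi => //.
  by apply/measurable_EFinP; apply: measurable_funM => //; exact: measurable_gauss.
move=> x _; rewrite /= lee_fin mulrAC normrM [leRHS]normrM mulrC ler_wpM2r//.
by rewrite ger0_norm ?gauss_ge0// (le_trans (dom x))// ler_norm.
Qed.

Lemma gauss_le_wider (m c : vec) (s b : R) : 0 < s -> s < b ->
  exists C, forall x, gauss m s x <= C * gauss c b x.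
Proof.
move=> s0 sb; have b0 : 0 < b by exact: lt_trans sb.
(* With this weight the recentering inequality, divided by [2 b^2], turns [|x - m|^2 / t] into
   exactly the exponent [|x - m|^2 / (2 s^2)]; the remaining term does not depend on [x] and gives
   [K]. *)
pose t := s ^+ 2 / b ^+ 2.
have t0 : 0 < t by rewrite divr_gt0// exprn_gt0.
have t1 : t < 1 by rewrite ltr_pdivrMr ?exprn_gt0// mul1r ltr_pXn2r// ?nnegrE ltW.
pose K := sqnorm (m - c) / (1 - t) / (b ^+ 2 *+ 2).
exists (normal_peak s ^+ n / normal_peak b ^+ n * expR K) => x.
have pb : normal_peak b ^+ n != 0 by rewrite gt_eqF// exprn_gt0// normal_peak_gt0// gt_eqF.
rewrite /gauss mulrACA -expRD [X in _ <= X * _](_ : _ = normal_peak s ^+ n); last by rewrite divfK.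
rewrite ler_wpM2l ?exprn_ge0 ?normal_peak_ge0// ler_expR.
have := sqnorm_recenter m c x t0 t1; set u := sqnorm _; set v := sqnorm (x - m) => H.
have b2 : 0 < b ^+ 2 *+ 2 by rewrite mulrn_wgt0// exprn_gt0.
have -> : - v / (s ^+ 2 *+ 2) = - (v / t) / (b ^+ 2 *+ 2).
  by rewrite /t; field; rewrite !gt_eqF.
by rewrite /K -mulrDl ler_pM2r ?invr_gt0//; lra.
Qed.

(** The form in which the slack [beta > 0] is used: integrability under one wide Gaussian passes to
    every narrower one, around any center. *)
Lemma gint_wider m c s b f : 0 < s -> s < b -> gint c b f -> gint m s f.
Proof. by move=> s0 sb; have [C HC] := gauss_le_wider m c s0 sb; exact: gint_dominated. Qed.

Lemma gint_sqnorm m s : 0 < s -> gint m s (fun x => sqnorm (x - m)).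
Proof.
move=> s0; split; first exact: measurable_sqnormB.
have s20 : 0 < s *+ 2 by rewrite mulrn_wgt0.
(* The comparison is with width [2 s]: the exponents differ by [3 q / (8 s^2)], where
   [q = |x - m|^2], and [q <= 4 s^2 exp (3 q / (8 s^2))] follows from [exp t >= 1 + t]. *)
pose K : R := (normal_peak s / normal_peak (s *+ 2)) ^+ n * (4 * s ^+ 2).
have [_ gi] := gint_cst m K s20.
apply: le_integrable gi => //.
  by apply/measurable_EFinP; apply: measurable_funM; [exact: measurable_sqnormB|exact: measurable_gauss].
have K0 : 0 <= K by rewrite /K !mulr_ge0 ?exprn_ge0 ?divr_ge0 ?normal_peak_ge0// ltW.
move=> x _; rewrite /= lee_fin ger0_norm; last by rewrite mulr_ge0 ?gauss_ge0 ?sqnorm_ge0.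
rewrite ger0_norm; last by rewrite mulr_ge0 ?gauss_ge0.
rewrite /K /gauss; set u := sqnorm _.
have p2 : normal_peak (s *+ 2) ^+ n != 0 by rewrite gt_eqF// exprn_gt0// normal_peak_gt0// gt_eqF.
rewrite expr_div_n [leRHS](_ : _ = normal_peak s ^+ n *
  (4 * s ^+ 2 * expR (- u / ((s *+ 2) ^+ 2 *+ 2)))); last by field.
rewrite mulrCA ler_wpM2l ?exprn_ge0 ?normal_peak_ge0//.
have s2 : 0 < s ^+ 2 by rewrite exprn_gt0.
have -> : - u / (s ^+ 2 *+ 2) = - u / ((s *+ 2) ^+ 2 *+ 2) - u * (3 / (8 * s ^+ 2)).
  by field; rewrite gt_eqF.
rewrite expRD mulrCA [leRHS]mulrC ler_wpM2l ?expR_ge0// expRN ler_pdivrMr ?expR_gt0//.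
have := expR_ge1Dx (u * (3 / (8 * s ^+ 2))) => H.
apply: (@le_trans _ _ (4 * s ^+ 2 * (u * (3 / (8 * s ^+ 2))))); last first.
  by rewrite ler_wpM2l ?mulr_ge0// ?ltW//; lra.
have -> : 4 * s ^+ 2 * (u * (3 / (8 * s ^+ 2))) = u * (3 / 2).
  by field; rewrite gt_eqF.
by have := sqnorm_ge0 (x - m); rewrite -/u => u0; lra.
Qed.

Lemma measurable_coordB (m : vec) i : measurable_fun setT (fun x : vec => x ord0 i - m ord0 i).
Proof. by apply: measurable_funB => //; exact: measurable_coord. Qed.

Lemma gint_coord_sqr m s i : 0 < s -> gint m s (fun x => (x ord0 i - m ord0 i) ^+ 2).
Proof.
move=> s0; apply: (gint_le _ (gint_sqnorm m s0)).
  by apply: measurable_funX; exact: measurable_coordB.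
move=> x; rewrite !ger0_norm ?sqnorm_ge0 ?sqr_ge0//.
by have := coord_sqr_le (x - m) i; rewrite !mxE.
Qed.

Lemma gint_mul m s (f g : vec -> R) : measurable_fun setT f -> measurable_fun setT g ->
  gint m s (fun x => f x ^+ 2) -> gint m s (fun x => g x ^+ 2) ->
  gint m s (fun x => f x * g x).
Proof.
move=> mf mg fi gi; apply: (gint_le _ (gintD fi gi)); first exact: measurable_funM.
move=> x; rewrite normrM [leRHS]ger0_norm ?addr_ge0 ?sqr_ge0//.
have := sqr_ge0 (`|f x| - `|g x|); rewrite -(real_normK (num_real (f x))) -(real_normK (num_real (g x))).
have := mulr_ge0 (normr_ge0 (f x)) (normr_ge0 (g x)).
by rewrite !expr2; nra.
Qed.

Lemma gint_sqr_self m s (f : vec -> R) : 0 < s -> measurable_fun setT f ->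
  gint m s (fun x => f x ^+ 2) -> gint m s f.
Proof.
move=> s0 mf fi.
have := gint_mul mf (measurable_cst (1 : R)) fi (gint_cst m (1 ^+ 2) s0).
by under eq_fun do rewrite mulr1.
Qed.

Lemma gint_coord m s i : 0 < s -> gint m s (fun x => x ord0 i - m ord0 i).
Proof.
by move=> s0; apply: gint_sqr_self => //; [exact: measurable_coordB|exact: gint_coord_sqr].
Qed.

(* Translating the mean by [h e_i] multiplies the density by
   [exp (h z / s^2 - h^2 / (2 s^2)) >= 1 + h z / s^2 - h^2 / (2 s^2)], so
   [h E z <= h^2 / 2] for every [h]. *)
Lemma gexp_coord m s i : 0 < s -> gexp m s (fun x => x ord0 i - m ord0 i) = 0.
Proof.
move=> s0; set E := gexp _ _ _.
have zi := gint_coord m i s0.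
(* The translation is taken to be [h = E], the very mean to be computed: the inequality then reads
   [E^2 <= E^2 / 2] and forces [E = 0]. *)
suff H : E * E <= E * E / 2 by apply/eqP; rewrite -sqrf_eq0 expr2; apply/eqP; nra.
pose m' : vec := m + E *: delta_mx 0 i.
have s2 : 0 < s ^+ 2 by rewrite exprn_gt0.
pose f (x : vec) := (1 - E ^+ 2 / (s ^+ 2 *+ 2)) + E / s ^+ 2 * (x ord0 i - m ord0 i).
have fi : gint m s f by apply: gintD; [exact: gint_cst|exact: gintZ].
have : gexp m s f <= 1.
  rewrite -lee_fin -gexpE// -(integral_gauss lamP m' s0).
  apply: le_integral => //; first by case: fi.
    have [_ gi] := gint_cst m' 1 s0.
    by apply: eq_integrable gi => // x _ /=; rewrite mul1r.
  move=> x _; rewrite lee_fin /gauss mulrCA ler_wpM2l ?exprn_ge0 ?normal_peak_ge0//.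
  have -> : sqnorm (x - m') = sqnorm (x - m) - 2 * E * (x ord0 i - m ord0 i) + E ^+ 2.
    rewrite /sqnorm (bigD1 i)//= [in RHS](bigD1 i)//= !mxE !eqxx mulr1.
    rewrite (eq_bigr (fun j => (x - m) ord0 j ^+ 2)); first by ring.
    by move=> j /negbTE ji; rewrite !mxE ji !andbF mulr0 addr0.
  set z := x ord0 i - m ord0 i.
  have -> : - (sqnorm (x - m) - 2 * E * z + E ^+ 2) / (s ^+ 2 *+ 2) =
     - sqnorm (x - m) / (s ^+ 2 *+ 2) + (E * z / s ^+ 2 - E ^+ 2 / (s ^+ 2 *+ 2)).
    by field; rewrite gt_eqF.
  rewrite expRD mulrC ler_wpM2l ?expR_ge0//.
  rewrite (le_trans _ (expR_ge1Dx _))// /f -/z.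
  by rewrite le_eqVlt; apply/orP; left; apply/eqP; field; rewrite gt_eqF.
rewrite gexpD//; [|exact: gint_cst|exact: gintZ].
rewrite gexpZ// (gexp_cst m (1 - E ^+ 2 / (s ^+ 2 *+ 2)))// -/E => H.
have : E * E / s ^+ 2 <= E * E / 2 / s ^+ 2.
  have -> : E * E / 2 / s ^+ 2 = E ^+ 2 / (s ^+ 2 *+ 2) by field; rewrite gt_eqF.
  have -> : E * E / s ^+ 2 = E / s ^+ 2 * E by rewrite mulrAC.
  by lra.
by rewrite ler_pM2r ?invr_gt0.
Qed.

(* Rescaling [s] to [r s] multiplies the density by
   [r^-n exp (q (1 - r^-2) / (2 s^2)) >= r^-n (1 + q (1 - r^-2) / (2 s^2))]; the
   integrated inequality is an equality at [r = 1], where its derivative vanishes. *)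
Lemma gexp_sqnorm m s : 0 < s -> gexp m s (fun x => sqnorm (x - m)) = n%:R * s ^+ 2.
Proof.
move=> s0; set V := gexp _ _ _.
have qi := gint_sqnorm m s0.
have s2 : 0 < s ^+ 2 by rewrite exprn_gt0.
pose W := V / s ^+ 2.
(* [r^2] times the gap in the integrated inequality, which clears the negative powers of [r] and
   leaves a polynomial. Its derivative at [1] is [n - W], so the minimum there gives [W = n]. *)
pose P (r : R) := r ^+ n.+2 - r ^+ 2 - W / 2 * (r ^+ 2 - 1).
have P_ge0 r : 0 < r -> 0 <= P r.
  move=> r0; have rs0 : 0 < r * s by rewrite mulr_gt0.
  pose k := (1 - r ^- 2) / (s ^+ 2 *+ 2).
  pose f (x : vec) := 1 + k * sqnorm (x - m).
  have fi : gint m s f by apply: gintD; [exact: gint_cst|exact: gintZ].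
  have H : gexp m s f <= r ^+ n.
    have gi := gint_cst m (r ^+ n) rs0.
    rewrite -(gexp_cst m (r ^+ n) rs0) -lee_fin -!gexpE//.
    apply: le_integral => //; [by case: fi|by case: gi|].
    move=> x _; rewrite lee_fin /gauss normal_peak_scale//=.
    have -> : (r^-1 * normal_peak s) ^+ n = r ^- n * normal_peak s ^+ n by rewrite exprMn exprVn.
    rewrite [leRHS]mulrA [X in _ <= X * _]mulrA divff ?mul1r; last by rewrite expf_neq0// gt_eqF.
    rewrite mulrCA ler_wpM2l ?exprn_ge0 ?normal_peak_ge0//.
    have -> : - sqnorm (x - m) / ((r * s) ^+ 2 *+ 2) =
        - sqnorm (x - m) / (s ^+ 2 *+ 2) + k * sqnorm (x - m).
      by rewrite /k exprMn; field; rewrite !gt_eqF.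
    by rewrite expRD mulrC ler_wpM2l ?expR_ge0// expR_ge1Dx.
  move: H; rewrite gexpD//; [|exact: gint_cst|exact: gintZ].
  rewrite gexpZ// (gexp_cst m 1)// -/V => H.
  have -> : P r = r ^+ 2 * (r ^+ n - (1 + k * V)).
    by rewrite /P /k /W !exprS; field; rewrite !gt_eqF.
  by rewrite mulr_ge0 ?sqr_ge0// subr_ge0.
have P1 : P 1 = 0 by rewrite /P !expr1n; ring.
have dP (r : R) : is_derive r 1 P (n.+2%:R * r ^+ n.+1 - 2 * r - W / 2 * (2 * r)).
  pose p : {poly R} := 'X ^+ n.+2 - 'X^2 - (W / 2) *: ('X^2 - 1%:P).
  have -> : P = (fun t => p.[t]) by apply/funext => t; rewrite /P /p !hornerE.
  apply: is_derive_eq.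
  rewrite mulr1 /p !(derivB, derivZ, derivXn, derivC).
  rewrite !(hornerMn, hornerXn, hornerC, hornerZ, hornerN, hornerD)/= expr1 -(mulr_natl (r ^+ n.+1)).
  by ring.
have dP0 : is_derive (1 : R) 1 P 0.
  have drv t : t \in `]0, 2[ -> derivable P t 1 by have := dP t.
  have in02 : (1 : R) \in `]0, 2[ by rewrite in_itv/=; apply/andP; split; lra.
  apply: (derive1_at_min _ drv in02) => // t; rewrite in_itv/= => /andP[t0 _].
  by rewrite P1 P_ge0.
have : n.+2%:R - 2 - W = 0.
  have := @derive_val _ _ _ _ _ _ _ dP0; have := @derive_val _ _ _ _ _ _ _ (dP 1).
  by move=> -> <-; rewrite expr1n; field.
have -> : n.+2%:R = n%:R + 2 :> R by rewrite -addn2 natrD.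
rewrite /W => H.
have -> : V = V / s ^+ 2 * s ^+ 2 by rewrite divfK// gt_eqF.
by congr (_ * _); lra.
Qed.

(** The exponent [|x - y|^2 / (2 s^2)] is split in halves. One stays in the kernel; the other is at
    least [|x - y|^2 / b^2] because [2 s <= b], and [|x - c|^2 <= 2 |x - y|^2 + 2 |y - c|^2] lets it
    absorb the division by [gauss c b]. The constant does not depend on [s]. *)
Lemma gauss_le_kernel (y c : vec) (b : R) : 0 < b -> exists2 K, 0 < K &
  forall s x, 0 < s -> s *+ 2 <= b ->
  gauss y s x <= K * (s ^- n * expR (- sqnorm (x - y) / (4 * s ^+ 2))) * gauss c b x.
Proof.
move=> b0; have pb : 0 < normal_peak b ^+ n by rewrite exprn_gt0// normal_peak_gt0// gt_eqF.
have p1 : 0 < normal_peak (1 : R) ^+ n by rewrite exprn_gt0// normal_peak_gt0// oner_eq0.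
exists (normal_peak 1 ^+ n / normal_peak b ^+ n * expR (sqnorm (y - c) / b ^+ 2)).
  by rewrite mulr_gt0 ?expR_gt0// divr_gt0.
move=> s x s0 sb; rewrite /gauss -[in leLHS](mulr1 s) normal_peak_scale// exprMn exprVn.
set e1 := expR _; set e2 := expR _; set e3 := expR _; set e4 := expR _.
have -> : normal_peak 1 ^+ n / normal_peak b ^+ n * e2 * (s ^- n * e3) * (normal_peak b ^+ n * e4)
  = s ^- n * normal_peak 1 ^+ n * (e2 * e3 * e4).
  by field; rewrite !gt_eqF// exprn_gt0.
have sn : 0 <= s ^- n * normal_peak 1 ^+ n by rewrite mulr_ge0 ?(ltW p1)// invr_ge0 exprn_ge0// ltW.
rewrite ler_wpM2l//.
rewrite /e1 /e2 /e3 /e4 -!expRD ler_expR.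
have := @sqnorm_recenter _ _ (1 / 2) y c x.
set u := sqnorm (x - c); set v := sqnorm (x - y); set w := sqnorm (y - c) => H.
have {}H : u <= v * 2 + w * 2.
  have /H {}H : (0 : R) < 1 / 2 by lra.
  have /H {}H : (1 : R) / 2 < 1 by lra.
  have -> : v * 2 = v / (1 / 2) by field.
  by have -> : w * 2 = w / (1 - 1 / 2) by field.
have v0 : 0 <= v by exact: sqnorm_ge0.
have s2 : 0 < s ^+ 2 by rewrite exprn_gt0.
have b2 : 0 < b ^+ 2 by rewrite exprn_gt0.
have H1 : u / (b ^+ 2 *+ 2) <= v / b ^+ 2 + w / b ^+ 2.
  rewrite -mulrDl [leRHS](_ : _ = (v * 2 + w * 2) / (b ^+ 2 *+ 2)); last by field; rewrite gt_eqF.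
  by rewrite ler_pM2r ?invr_gt0// mulrn_wgt0.
have H2 : v / b ^+ 2 <= v / (4 * s ^+ 2).
  rewrite ler_wpM2l// lef_pV2 ?posrE ?mulr_gt0//.
  have -> : 4 * s ^+ 2 = (s *+ 2) ^+ 2 by ring.
  by rewrite ler_pXn2r// ?nnegrE ?mulrn_wge0 ?ltW.
have -> : - v / ((s * 1) ^+ 2 *+ 2) = - (v / (4 * s ^+ 2)) - v / (4 * s ^+ 2).
  by rewrite mulr1; field; rewrite gt_eqF.
by rewrite !mulNr; lra.
Qed.

End gauss_expectation.

(** * The maximal inequality for cubes *)

Section maximal.
Context {R : realType} {n : nat}.
Local Notation vec := 'rV[R]_n.
Variables (lam : {measure set vec -> \bar R}) (lamP : is_lebesgue_rV lam).
Variable nu : {measure set vec -> \bar R}.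

Lemma measurable_cube (y : vec) (r : R) : measurable (cube y r).
Proof. exact: measurable_rect. Qed.

Let Ucube (s : seq (vec * R)) : set vec := \big[setU/set0]_(b <- s) cube b.1 b.2.

Let UcubeP s x : Ucube s x <-> exists2 b, b \in s & cube b.1 b.2 x.
Proof. by rewrite /Ucube -bigcup_seq. Qed.

Let measurable_Ucube s : measurable (Ucube s).
Proof. by apply: bigsetU_measurable => b _; exact: measurable_cube. Qed.

Lemma cube_meet_sub (y z : vec) (r t : R) : t <= r ->
  cube y r `&` cube z t !=set0 -> cube z t `<=` cube y (r *+ 3).
Proof.
move=> tr [w [yw zw]] x zx i; have := yw i; have := zw i; have := zx i.
by rewrite /= !in_itv/= => /andP[? ?] /andP[? ?] /andP[? ?]; apply/andP; split; lra.
Qed.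

(* Vitali's greedy selection: the largest cube is disjoint from the cubes kept for
   the recursion, and its threefold dilation covers the cubes thrown away. *)
Lemma vitali_cubes (c : R) (s : seq (vec * R)) : 0 < c ->
  (forall b, b \in s -> 0 < b.2 /\ ((c * b.2 ^+ n)%:E <= nu (cube b.1 b.2))%E) ->
  (lam (Ucube s) <= (6 ^+ n / c)%:E * nu (Ucube s))%E.
Proof.
move=> c0 sP; pose ge2 (b b' : vec * R) := b'.2 <= b.2.
have ge2_trans : transitive ge2 by move=> b2 b1 b3 h1 h2; exact: le_trans h2 h1.
have -> : Ucube s = Ucube (sort ge2 s).
  by rewrite /Ucube; apply: perm_big; rewrite perm_sym perm_sort.
have : sorted ge2 (sort ge2 s) by apply: sort_sorted => b b'; exact: le_total.
have : forall b, b \in sort ge2 s -> 0 < b.2 /\ ((c * b.2 ^+ n)%:E <= nu (cube b.1 b.2))%E.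
  by move=> b; rewrite mem_sort; exact: sP.
move: (sort ge2 s) => {sP}s; have [k] := ubnP (size s).
elim: k s => // k IH [|b s] /= sk sP ss.
  by rewrite /Ucube big_nil !measure0 mule0.
pose keep := [seq b' <- s | `[< cube b.1 b.2 `&` cube b'.1 b'.2 = set0 >]].
have bs : {in s, forall b', b'.2 <= b.2}.
  by move=> b' b's; have /allP := order_path_min ge2_trans ss; apply.
have keep_sub : {subset keep <= s} by move=> b'; rewrite mem_filter => /andP[].
have [b0 bnu] := sP b (mem_head _ _).
have IHk : (lam (Ucube keep) <= (6 ^+ n / c)%:E * nu (Ucube keep))%E.
  apply: IH.
  - by move: sk; rewrite ltnS; apply: leq_ltn_trans; rewrite size_filter count_size.
  - by move=> b' /keep_sub b's; apply: sP; rewrite inE b's orbT.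
  - by apply: sorted_filter => //; exact: path_sorted ss.
have mb r := measurable_cube b.1 r.
have cover : Ucube (b :: s) `<=` cube b.1 (b.2 *+ 3) `|` Ucube keep.
  move=> x /UcubeP[b']; rewrite inE => /predU1P[->|b's] b'x.
    left => i; have := b'x i; rewrite /= !in_itv/= => /andP[? ?].
    by apply/andP; split; lra.
  have [bb'|/eqP/set0P bb'] := pselect (cube b.1 b.2 `&` cube b'.1 b'.2 = set0).
    by right; apply/UcubeP; exists b' => //; rewrite mem_filter b's andbT; apply/asboolP.
  by left; apply: (cube_meet_sub (bs _ b's) bb').
have disj : cube b.1 b.2 `&` Ucube keep = set0.
  rewrite -subset0 => x [bx /UcubeP[b']]; rewrite mem_filter => /andP[/asboolP bb' _] b'x.
  by rewrite -bb'.
have sub : cube b.1 b.2 `|` Ucube keep `<=` Ucube (b :: s).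
  move=> x [bx|/UcubeP[b' /keep_sub b's b'x]]; apply/UcubeP.
    by exists b => //; exact: mem_head.
  by exists b' => //; rewrite inE b's orbT.
have mk := measurable_Ucube keep; have mbs := measurable_Ucube (b :: s).
apply: (@le_trans _ _ (lam (cube b.1 (b.2 *+ 3)) + lam (Ucube keep))%E).
  apply: (le_trans _ (measureU2 lam (mb _) mk)).
  by apply: le_measure => //; rewrite inE//; exact: measurableU.
apply: (@le_trans _ _ ((6 ^+ n / c)%:E * nu (cube b.1 b.2 `|` Ucube keep))%E); last first.
  apply: lee_wpmul2l; first by rewrite lee_fin divr_ge0 ?exprn_ge0// ltW.
  by apply: le_measure => //; rewrite inE//; exact: measurableU.
rewrite measureU// muleDr ?ge0_adde_def ?inE ?measure_ge0//.
(* The threefold dilation of a cube of half-side [r] has side [6 r], whence [6 ^+ n]. *)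
apply: leeD => //; rewrite lam_cube//; last by rewrite mulrn_wge0// ltW.
apply: (@le_trans _ _ ((6 ^+ n / c)%:E * (c * b.2 ^+ n)%:E)%E).
  rewrite -EFinM lee_fin mulrA divfK ?gt_eqF// -exprMn le_eqVlt; apply/orP; left.
  by apply/eqP; congr (_ ^+ n); ring.
by apply: lee_wpmul2l => //; rewrite lee_fin divr_ge0 ?exprn_ge0// ltW.
Qed.

(** The cubes with large [nu]-mass are uncountably many. Each is enclosed in a rational cube at most
    twice as large, so countably many suffice, and the covering bound for finite families passes to
    their increasing union. The enlargement costs [2 ^+ n]: hence [c'] and [12 = 6 * 2]. *)
Lemma maximal_weak_type (c : R) : 0 < c -> exists U : set vec,
  [/\ measurable U,
      forall y r, 0 < r -> ((c * r ^+ n)%:E < nu (cube y r))%E -> U y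
    & (lam U <= (12 ^+ n / c)%:E * nu setT)%E].
Proof.
move=> c0; pose c' := c / 2 ^+ n.
have c'0 : 0 < c' by rewrite divr_gt0 ?exprn_gt0.
pose Q : countType := ('rV[rat]_n * rat)%type.
pose toC (q : Q) : vec * R := (map_mx (@ratr R) q.1, ratr q.2).
pose G (b : vec * R) := `[< 0 < b.2 /\ ((c' * b.2 ^+ n)%:E <= nu (cube b.1 b.2))%E >].
pose L N : seq (vec * R) := [seq b <- [seq toC q | q <- pmap unpickle (iota 0 N)] | G b].
have LS N N' : (N <= N')%N -> {subset L N <= L N'}.
  move=> NN' b; rewrite !mem_filter => /andP[-> /mapP[q qN ->]] /=; apply/mapP; exists q => //.
  move: qN; rewrite !mem_pmap => /mapP[j jN ->]; apply/mapP; exists j => //.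
  by move: jN; rewrite !mem_iota /= !add0n => /leq_trans; exact.
have ndU : nondecreasing_seq (fun N => Ucube (L N)).
  by move=> N N' NN'; apply/subsetPset => x /UcubeP[b bL bx]; apply/UcubeP; exists b => //; exact: LS bL.
have mU : measurable (\bigcup_N Ucube (L N)) by apply: bigcupT_measurable.
exists (\bigcup_N Ucube (L N)); split=> //.
- move=> y r r0 yr.
  (* A half-side above [3 r / 2] still covers [cube y r] after the center moves by less than
     [r / 2]; one below [2 r] keeps [c' * rho ^+ n] under [c * r ^+ n]. *)
  have [rho] : exists rho : rat, ratr rho \in `](3 / 2 * r), (2 * r)[.
    by apply: rat_in_itvoo; lra.
  rewrite in_itv/= => /andP[rho1 rho2].
  have /choice[z zP] : forall i, exists q : rat, ratr q \in `](y ord0 i - r / 2), (y ord0 i + r / 2)[.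
    by move=> i; apply: rat_in_itvoo; lra.
  pose q : Q := (\row_i z i, rho).
  have sub : cube y r `<=` cube (toC q).1 (toC q).2.
    move=> x yx i; have := yx i; have := zP i; rewrite /= !in_itv/= !mxE => /andP[? ?] /andP[? ?].
    by apply/andP; split; lra.
  exists (pickle q).+1 => //; apply/UcubeP; exists (toC q); last first.
    by apply: sub => i; rewrite /= in_itv/=; apply/andP; split; lra.
  rewrite mem_filter; apply/andP; split; last first.
    apply/mapP; exists q => //; rewrite mem_pmap; apply/mapP; exists (pickle q).
      by rewrite mem_iota/= add0n.
    by rewrite pickleK.
  apply/asboolP; split; first by rewrite /=; lra.
  apply: (@le_trans _ _ (c * r ^+ n)%:E).
    rewrite lee_fin /c' -mulrA ler_pM2l// mulrC -expr_div_n lerXn2r// ?nnegrE//=; lra.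
  apply: (le_trans (ltW yr)); apply: le_measure; rewrite ?inE//; exact: measurable_cube.
- have mUN N : measurable (Ucube (L N)) by [].
  have := nondecreasing_cvg_mu (mu := lam) mUN mU ndU => /cvg_lim <-//.
  apply: lime_le.
    by apply: ereal_nondecreasing_is_cvgn => N N' NN'; apply: le_measure; rewrite ?inE//; apply/subsetPset; exact: ndU.
  apply: nearW => N; apply: (le_trans (vitali_cubes c'0 _)).
    by move=> b; rewrite mem_filter => /andP[/asboolP].
  rewrite (_ : 12 ^+ n / c = 6 ^+ n / c'); last first.
    rewrite /c' invf_div mulrA -exprMn; congr (_ ^+ n / c); ring.
  apply: lee_wpmul2l; first by rewrite lee_fin divr_ge0 ?exprn_ge0// ltW.
  by apply: le_measure; rewrite ?inE.
Qed.

(** The factorial comes from [exp u >= u ^ (n + 1) / (n + 1)!] at [u = 4 ^ k / 4]; the base [16] is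
    large enough to replace [u] by a multiple of [2 ^ (k + 1)], and [A >= 1] settles the smallest
    cube. *)
Let A : R := (n.+1)`!%:R * 16 ^+ n.+1.

(* The coefficients decay like [2 ^ (- k (n + 1))] whereas the volumes of the cubes
   grow like [2 ^ (k n)], so the series stays summable after integration. *)
Lemma kernel_le_cubes (y x : vec) (s : R) : 0 < s ->
  ((expR (- sqnorm (x - y) / (4 * s ^+ 2)))%:E <=
   \sum_(k <oo) (A * (2 ^+ n.+1) ^- k * \1_(cube y (2 ^+ k * s)) x)%:E)%E.
Proof.
move=> s0; have A0 : 0 <= A by rewrite mulr_ge0// exprn_ge0.
have t0 k : 0 <= A * (2 ^+ n.+1) ^- k * \1_(cube y (2 ^+ k * s)) x.
  by rewrite !mulr_ge0// invr_ge0 !exprn_ge0.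
have in_cube r : (forall i, `|x ord0 i - y ord0 i| < r) -> cube y r x.
  by move=> H i; have := H i; rewrite /= in_itv/= ltr_norml => /andP[? ?]; apply/andP; split; lra.
have exk : exists k, `[< cube y (2 ^+ k * s) x >].
  pose M := \sum_(i < n) `|x ord0 i - y ord0 i|.
  exists (Num.truncn (M / s)).+1; apply/asboolP/in_cube => i.
  apply: (@le_lt_trans _ _ M); first by rewrite /M (bigD1 i)//= lerDl sumr_ge0.
  rewrite -ltr_pdivrMr//; apply: (lt_le_trans (truncnS_gt _)).
  by rewrite -natrX ler_nat ltnW// ltn_expl.
(* The term of the smallest dyadic cube containing [x] is enough. Unless it is the first, [x] misses
   the preceding cube, so some coordinate is at distance at least [2 ^ k * s] from that of [y] and
   the exponential is at most [exp (- 4 ^ k / 4)]. *)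
have [k xk kmin] := ex_minnP exk.
apply: (@le_trans _ _ (A * (2 ^+ n.+1) ^- k * \1_(cube y (2 ^+ k * s)) x)%:E); last first.
  apply: (le_trans _ (@nneseries_lim_ge _ _ xpredT 0%N k.+1 _)).
    rewrite big_nat_recr//= leeDr// sume_ge0// => j _; by rewrite lee_fin.
  by move=> j _ _; rewrite lee_fin.
rewrite lee_fin indicE mem_set ?mulr1; last exact/asboolP.
have fact1 : 1 <= (n.+1)`!%:R :> R by rewrite ler1n fact_gt0.
case: k xk kmin => [|k] xk kmin.
  rewrite expr0 invr1 mulr1 (@le_trans _ _ 1)//.
    by rewrite -expR0 ler_expR mulr_le0_ge0 ?oppr_le0 ?sqnorm_ge0// invr_ge0 mulr_ge0// sqr_ge0.
  by rewrite /A mulr_ege1// exprn_ege1// ler1n.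
have [i xi] : exists i, 2 ^+ k * s <= `|x ord0 i - y ord0 i|.
  apply: contrapT => /forallNP H; have : (k.+1 <= k)%N.
    by apply: kmin; apply/asboolP/in_cube => i; rewrite ltNge; apply/negP; exact: H.
  by rewrite ltnn.
have sk0 : 0 <= 2 ^+ k * s by rewrite mulr_ge0 ?exprn_ge0// ltW.
have q_ge : 4 ^+ k * s ^+ 2 <= sqnorm (x - y).
  apply: le_trans (coord_sqr_le (x - y) i); rewrite !mxE -[leRHS]real_normK ?num_real//.
  rewrite (_ : 4 ^+ k * s ^+ 2 = (2 ^+ k * s) ^+ 2).
    by rewrite lerXn2r ?nnegrE.
  by rewrite exprMn -exprM mulnC exprM; congr (_ ^+ k * _); ring.
pose u : R := 4 ^+ k / 4.
have u0 : 0 <= u by rewrite divr_ge0 ?exprn_ge0.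
have u1 : 0 < u by rewrite divr_gt0 ?exprn_gt0.
apply: (@le_trans _ _ (expR (- u))).
  rewrite ler_expR mulNr lerN2 /u ler_pdivlMr ?mulr_gt0 ?exprn_gt0//.
  by rewrite (_ : _ * (4 * s ^+ 2) = 4 ^+ k * s ^+ 2)//; field.
rewrite expRN -[leRHS]invrK lef_pV2 ?posrE ?expR_gt0 ?invr_gt0 ?mulr_gt0 ?invr_gt0 ?exprn_gt0 ?ltr0n ?fact_gt0//.
apply: (@le_trans _ _ (u ^+ n.+1 / (n.+1)`!%:R)); last first.
  by rewrite (le_trans _ (expR_ge1Dxn n u0))// lerDr.
have F0 : (n.+1)`!%:R != 0 :> R by rewrite pnatr_eq0 -lt0n fact_gt0.
have -> : (A * (2 ^+ n.+1) ^- k.+1)^-1 = (n.+1)`!%:R^-1 * ((2 ^+ n.+1) ^+ k.+1 / 16 ^+ n.+1).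
  by rewrite /A; field; rewrite F0 !expf_neq0// ?expf_neq0.
rewrite [leRHS]mulrC ler_pM2l ?invr_gt0 ?ltr0n ?fact_gt0//.
rewrite -exprM mulnC exprM -exprVn -exprMn lerXn2r ?nnegrE ?mulr_ge0 ?exprn_ge0 ?invr_ge0//.
rewrite /u ler_pdivlMr// exprS (_ : 4 ^+ k = 2 ^+ k * 2 ^+ k); last first.
  by rewrite -exprMn; congr (_ ^+ k); ring.
have := exprn_ege1 k (ler1n R 2); rewrite /=.
by have : 1 <= 2 ^+ k :> R by [rewrite exprn_ege1// ler1n]; nra.
Qed.

(** Termwise integration gives [A * 2 ^ (- k (n + 1)) * c * (2 ^ k * s) ^ n = A * c * s ^ n * 2 ^ (-
    k)], and the geometric series contributes the factor 2. *)
Lemma kernel_maximal (y : vec) (c s : R) : 0 <= c -> 0 < s ->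
  (forall r, 0 < r -> (nu (cube y r) <= (c * r ^+ n)%:E)%E) ->
  (\int[nu]_x (expR (- sqnorm (x - y) / (4 * s ^+ 2)))%:E <= (A *+ 2 * c * s ^+ n)%:E)%E.
Proof.
move=> c0 s0 Hc; have A0 : 0 <= A by rewrite mulr_ge0// exprn_ge0.
pose t k x := A * (2 ^+ n.+1) ^- k * \1_(cube y (2 ^+ k * s)) x.
have t0 k x : 0 <= t k x by rewrite !mulr_ge0// invr_ge0 !exprn_ge0.
have mt k : measurable_fun setT (fun x => (t k x)%:E).
  by apply/measurable_EFinP; apply: measurable_funM => //; apply: measurable_indic; exact: measurable_cube.
apply: (@le_trans _ _ (\int[nu]_x \sum_(k <oo) (t k x)%:E)%E).
  have e0 x : setT x -> (0 <= (expR (- sqnorm (x - y) / (4 * s ^+ 2)))%:E)%E.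
    by rewrite lee_fin expR_ge0.
  have me : measurable_fun setT (fun x : vec => (expR (- sqnorm (x - y) / (4 * s ^+ 2)))%:E).
    apply/measurable_EFinP; apply: (measurableT_comp (@measurable_expR R)).
    by apply: measurable_funM => //; apply: measurableT_comp => //; exact: measurable_sqnormB.
  have u0 x : setT x -> (0 <= \sum_(k <oo) (t k x)%:E)%E.
    by move=> _; apply: nneseries_ge0 => k _ _; rewrite lee_fin.
  have mu : measurable_fun setT (fun x => \sum_(k <oo) (t k x)%:E)%E.
    by apply: ge0_emeasurable_sum => // k x _ _; rewrite lee_fin.
  apply: ge0_le_integral => //.
  by move=> x _; exact: kernel_le_cubes.
rewrite integral_nneseries//; last by move=> k x _; rewrite lee_fin.
apply: (@le_trans _ _ (\sum_(k <oo) (A * c * s ^+ n * 2 / (2 ^ (k + 1))%:R)%:E)%E).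
  apply: lee_nneseries => [k _ _|k _]; first by apply: integral_ge0 => x _; rewrite lee_fin.
  have Ak : 0 <= A * (2 ^+ n.+1) ^- k by rewrite mulr_ge0// invr_ge0 !exprn_ge0.
  under eq_integral do rewrite EFinM.
  have m1 : measurable_fun setT (fun x => (\1_(cube y (2 ^+ k * s)) x)%:E : \bar R).
    by apply/measurable_EFinP; apply: measurable_indic; exact: measurable_cube.
  rewrite ge0_integralZl_EFin//.
  rewrite integral_indic ?setIT//; last exact: measurable_cube.
  have sk : 0 < 2 ^+ k * s by rewrite mulr_gt0 ?exprn_gt0.
  apply: (le_trans (lee_wpmul2l _ (Hc _ sk))); first by rewrite lee_fin.
  rewrite -EFinM lee_fin le_eqVlt; apply/orP; left; apply/eqP.
  rewrite exprMn addn1 natrX -!exprM exprS [in X in X ^-1](_ : (n.+1 * k = k + k * n)%N); last by rewrite mulSn mulnC.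
  by rewrite exprD; field; rewrite ?expf_neq0.
have -> : (\sum_(k <oo) (A * c * s ^+ n * 2 / (2 ^ (k + 1))%:R)%:E =
    (A * c * s ^+ n * 2 / 2 ^+ 0)%:E)%E.
  by apply/cvg_lim => //; exact: cvg_geometric_eseries_half.
by rewrite expr0 divr1 (_ : A *+ 2 * c * s ^+ n = A * c * s ^+ n * 2)//; ring.
Qed.

End maximal.

(** * Almost everywhere convergence of Gaussian averages *)

Section ae_convergence.
Context {R : realType} {n : nat}.
Local Notation vec := 'rV[R]_n.
Variables (lam : {measure set vec -> \bar R}) (lamP : is_lebesgue_rV lam).
Local Notation gint := (gint lam).
Local Notation gexp := (gexp lam).

Lemma gint_abs m s (f : vec -> R) : gint m s f -> gint m s (fun x => `|f x|).
Proof.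
move=> fi; apply: (gint_le _ fi); first by case: fi => mf _; exact: measurableT_comp.
by move=> x; rewrite normr_id.
Qed.

Lemma gintB m s (f g : vec -> R) : gint m s f -> gint m s g -> gint m s (fun x => f x - g x).
Proof.
move=> fi gi; have := gintD fi (gintZ (-1) gi).
by under eq_fun do rewrite mulN1r.
Qed.

Lemma gexpB m s (f g : vec -> R) : gint m s f -> gint m s g ->
  gexp m s (fun x => f x - g x) = gexp m s f - gexp m s g.
Proof.
move=> fi gi; have := gexpD fi (gintZ (-1) gi).
by under eq_fun do rewrite mulN1r; rewrite gexpZ// mulN1r.
Qed.

Lemma gexp_dist m s (f g : vec -> R) : gint m s f -> gint m s g ->
  `|gexp m s f - gexp m s g| <= gexp m s (fun x => `|f x - g x|).
Proof.
move=> fi gi; have di := gintB fi gi; have ai := gint_abs di.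
rewrite -gexpB// ler_norml; apply/andP; split.
  rewrite lerNl -mulN1r -gexpZ//; apply: le_gexp => //; first exact: gintZ.
  by move=> x; rewrite mulN1r -normrN ler_norm.
by apply: le_gexp => // x; exact: ler_norm.
Qed.

Lemma gint_indic m s (S : set vec) : 0 < s -> measurable S -> gint m s (\1_S : vec -> R).
Proof.
move=> s0 mS; apply: (gint_le _ (gint_cst lamP m 1 s0)); first exact: measurable_indic.
by move=> x; rewrite normr1 indicE; case: (_ \in _); rewrite ?normr1 ?normr0.
Qed.

Variables (c : vec) (b : R).
Hypothesis b0 : 0 < b.

(** [K] is chosen before [f], [d] and [s]: the [s ^- n] of the Gaussian kernel cancels the [s ^+ n]
    of the maximal bound, so the estimate is uniform as the width tends to 0. *)
Lemma gexp_maximal (y : vec) : exists2 K, 0 < K & forall (f : vec -> R) (d : R),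
  (forall x, 0 <= f x) -> gint c b f -> 0 <= d ->
  (forall r, 0 < r ->
     (\int[lam]_(x in cube y r) (f x * gauss c b x)%:E <= (d * r ^+ n)%:E)%E) ->
  forall s, 0 < s -> s *+ 2 <= b -> gexp y s f <= K * d.
Proof.
have [K K0 HK] := gauss_le_kernel y c b0.
pose A : R := (n.+1)`!%:R * 16 ^+ n.+1.
have A0 : 0 < A by rewrite mulr_gt0 ?exprn_gt0// ltr0n fact_gt0.
exists (K * (A *+ 2)); first by rewrite mulr_gt0// mulrn_wgt0.
move=> f d f0 fi d0 Hd s s0 sb; have [mf fint] := fi.
have sb' : s < b by apply: lt_le_trans sb; rewrite mulr2n ltrDl.
have fi' := gint_wider y s0 sb' fi.
have p0 x : 0 <= f x * gauss c b x by rewrite mulr_ge0 ?gauss_ge0.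
have mp : measurable_fun setT (fun x => f x * gauss c b x).
  by apply: measurable_funM => //; exact: measurable_gauss.
have e0 x : 0 <= expR (- sqnorm (x - y) / (4 * s ^+ 2)) by exact: expR_ge0.
have me : measurable_fun setT (fun x : vec => (expR (- sqnorm (x - y) / (4 * s ^+ 2)))%:E).
  apply/measurable_EFinP; apply: (measurableT_comp (@measurable_expR R)).
  by apply: measurable_funM => //; apply: measurableT_comp => //; exact: measurable_sqnormB.
have Ks0 : 0 <= K * s ^- n by rewrite mulr_ge0 ?(ltW K0)// invr_ge0 exprn_ge0// ltW.
have := @kernel_maximal _ _ (density_measure lam p0 mp) y d s d0 s0 Hd.
have e0E x : (0 <= (expR (- sqnorm (x - y) / (4 * s ^+ 2)))%:E)%E by rewrite lee_fin.
rewrite (@ge0_integral_density_measure _ _ _ lam _ p0 mp _ me e0E) => H; rewrite -lee_fin -gexpE//.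
apply: (@le_trans _ _ (\int[lam]_x ((K * s ^- n)%:E *
    ((expR (- sqnorm (x - y) / (4 * s ^+ 2)))%:E * (f x * gauss c b x)%:E)))%E).
  have me' : measurable_fun setT (fun x : vec => ((expR (- sqnorm (x - y) / (4 * s ^+ 2)))%:E *
     (f x * gauss c b x)%:E)%E).
    by apply: emeasurable_funM => //; exact/measurable_EFinP.
  apply: ge0_le_integral => //.
  - by move=> x _; rewrite lee_fin mulr_ge0 ?gauss_ge0.
  - apply/measurable_EFinP; apply: measurable_funM => //; exact: measurable_gauss.
  - by apply: emeasurable_funM => //; exact: measurable_cst.
  move=> x _; rewrite -!EFinM lee_fin.
  have := HK s x s0 sb => {}HK; rewrite (le_trans (ler_wpM2l (f0 x) HK))// le_eqVlt.
  by apply/orP; left; apply/eqP; ring.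
rewrite ge0_integralZl_EFin//; last 2 first.
- by move=> x _; rewrite mule_ge0 ?lee_fin.
- by apply: emeasurable_funM => //; exact/measurable_EFinP.
apply: (le_trans (lee_wpmul2l _ H)); first by rewrite lee_fin.
rewrite -EFinM lee_fin le_eqVlt; apply/orP; left; apply/eqP; rewrite /A.
by field; rewrite expf_neq0// gt_eqF.
Qed.

(** Integrability is part of the property because [gexp] is additive only on integrable functions,
    and closure under sums and limits is what is wanted. *)
Definition ae_cvg (f : vec -> R) : Prop :=
  gint c b f /\ {ae lam, forall y, gexp y s f @[s --> 0^'+] --> f y}.

Let near_gint (f : vec -> R) y : gint c b f -> \forall s \near 0^'+, gint y s f.
Proof.
move=> fi; near=> s; apply: gint_wider fi; first by near: s; exact: nbhs_right_gt.
by near: s; exact: nbhs_right_lt.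
Unshelve. all: by end_near. Qed.

Lemma ae_cvgD f g : ae_cvg f -> ae_cvg g -> ae_cvg (fun x => f x + g x).
Proof.
move=> [fi fc] [gi gc]; split; first exact: gintD.
apply: filterS2 fc gc => y fy gy.
have : gexp y s f + gexp y s g @[s --> 0^'+] --> f y + g y by exact: cvgD.
apply: cvg_trans; apply: near_eq_cvg.
by apply: filterS2 (near_gint y fi) (near_gint y gi) => s fs gs; rewrite gexpD.
Qed.

Lemma ae_cvgZ k f : ae_cvg f -> ae_cvg (fun x => k * f x).
Proof.
move=> [fi fc]; split; first exact: gintZ.
apply: filterS fc => y fy.
have : k * gexp y s f @[s --> 0^'+] --> k * f y by apply: cvgM => //; exact: cvg_cst.
apply: cvg_trans; apply: near_eq_cvg.
by apply: filterS (near_gint y fi) => s fs; rewrite gexpZ.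
Qed.

Lemma ae_cvg_cst k : ae_cvg (cst k).
Proof.
split; first exact: gint_cst.
apply: aeW => y; have : (k : R) @[s --> (0 : R)^'+] --> k by exact: cvg_cst.
apply: cvg_trans; apply: near_eq_cvg.
by near=> s; rewrite (gexp_cst lamP y k)//; near: s; exact: nbhs_right_gt.
Unshelve. all: by end_near. Qed.

Lemma ae_cvg_sum (I : Type) (r : seq I) (f : I -> vec -> R) :
  (forall i, ae_cvg (f i)) -> ae_cvg (fun x => \sum_(i <- r) f i x).
Proof.
move=> fc; elim: r => [|i r IH]; first by under eq_fun do rewrite big_nil; exact: ae_cvg_cst.
by under eq_fun do rewrite big_cons; exact: ae_cvgD.
Qed.

Lemma half_pow_lt (e : R) : 0 < e -> exists k0, forall k, (k0 <= k)%N -> 2 ^- k < e.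
Proof.
move=> e0; exists (Num.truncn e^-1).+1 => k k0.
rewrite -[ltRHS]invrK ltf_pV2 ?posrE ?exprn_gt0 ?invr_gt0//.
apply: (lt_le_trans (truncnS_gt _)); rewrite -natrX ler_nat.
by apply: (leq_trans k0); rewrite ltnW// ltn_expl.
Qed.

(* Along a subsequence with [gexp |F k - f| <= 4^-k] the maximal inequality and
   Borel-Cantelli bound, for almost every [y] and all large [k], the distance between
   the averages of [F k] and [f] around [y] by [K_y 2^-k], uniformly in the width. *)
Lemma ae_cvg_lim (f : vec -> R) (F : nat -> vec -> R) : (forall k, ae_cvg (F k)) ->
  gint c b f -> gexp c b (fun x => `|F k x - f x|) @[k --> \oo] --> 0 -> ae_cvg f.
Proof.
move=> Fc fi F0; split=> //.
have e4 k : (0 : R) < 4 ^- k by rewrite invr_gt0 exprn_gt0.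
have /choice[m mP] : forall k, exists m, gexp c b (fun x => `|F m x - f x|) <= 4 ^- k.
  move=> k; have /cvgrPdist_le/(_ _ (e4 k))[N _ NP] := F0.
  exists N; have := NP N (leqnn N); rewrite sub0r normrN; apply: le_trans; exact: ler_norm.
pose h k := F (m k); pose d k x := `|h k x - f x|.
have hi k : gint c b (h k) by case: (Fc (m k)).
have di k : gint c b (d k) by apply: gint_abs; exact: gintB.
have d0 k x : 0 <= d k x by exact: normr_ge0.
pose p k x := d k x * gauss c b x.
have p0 k x : 0 <= p k x by rewrite mulr_ge0 ?gauss_ge0.
have mp k : measurable_fun setT (p k).
  by apply: measurable_funM; [case: (di k)|exact: measurable_gauss].
have intp k : (\int[lam]_x (p k x)%:E <= (4 ^- k)%:E)%E by rewrite gexpE// lee_fin; exact: mP.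
have e2 k : (0 : R) < 2 ^- k by rewrite invr_gt0 exprn_gt0.
have /choice[U UP] k := maximal_weak_type lamP (density_measure lam (p0 k) (mp k)) (e2 k).
(* Outside [U k] the averages of [d k] around [y] are controlled, outside [V k] its value at [y]. A
   total mass of [4 ^- k] against a threshold of [2 ^- k] gives both sets measure of order [2 ^- k],
   which is summable. *)
pose V k := [set x | 2 ^- k <= p k x].
have mV k : measurable (V k).
  rewrite -[V k]setTI; have := mp k measurableT _ (measurable_itv `[2 ^- k, +oo[).
  by congr measurable; congr (_ `&` _); apply/seteqP; split => x; rewrite /V/= in_itv/= andbT.
have lV k : (lam (V k) <= (2 ^- k)%:E)%E.
  have : ((2 ^- k)%:E * lam (V k) <= (4 ^- k)%:E)%E.
    apply: le_trans (intp k); rewrite -integral_cst//.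
    apply: (@le_trans _ _ (\int[lam]_(x in V k) (p k x)%:E)%E).
      apply: ge0_le_integral => //; do ?[by move=> x _; rewrite lee_fin ?ltW
        | by apply: measurable_funTS; exact/measurable_EFinP | by move=> x Vx; rewrite lee_fin].
    apply: ge0_subset_integral => //; first exact/measurable_EFinP.
    by move=> x _; rewrite lee_fin.
  have -> : 4 ^- k = 2 ^- k * 2 ^- k :> R.
    by rewrite -invfM -exprMn; congr ((_ ^+ k)^-1); ring.
  by rewrite EFinM lee_pmul2l// lte_fin.
have mU k : measurable (U k) by case: (UP k).
have lU k : (lam (U k) <= (12 ^+ n * 2 ^- k)%:E)%E.
  have [_ _] := UP k; move=> /le_trans; apply.
  apply: (@le_trans _ _ ((12 ^+ n / 2 ^- k)%:E * (4 ^- k)%:E)%E).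
    apply: lee_wpmul2l; first by rewrite lee_fin divr_ge0 ?exprn_ge0// invr_ge0 exprn_ge0.
    exact: intp.
  rewrite -EFinM lee_fin invrK -mulrA ler_pM2l ?exprn_gt0// (_ : 4 ^+ k = 2 ^+ k * 2 ^+ k); last first.
    by rewrite -exprMn; congr (_ ^+ k); ring.
  by rewrite invfM mulrA divff ?mul1r// expf_neq0.
have mUV k : measurable (U k `|` V k) by exact: measurableU.
have N0 : lam (lim_sup_set (fun k => U k `|` V k)) = 0%E.
  apply: lim_sup_set_cvg0 => //.
  pose C : R := (12 ^+ n + 1) * 2.
  apply: (@le_lt_trans _ _ (\sum_(k <oo) (C / (2 ^ (k + 1))%:R)%:E)%E).
    apply: lee_nneseries => // k _; apply: (le_trans (measureU2 _ (mU k) (mV k))).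
    apply: (le_trans (leeD (lU k) (lV k))); rewrite -EFinD lee_fin le_eqVlt; apply/orP; left.
    by apply/eqP; rewrite /C addn1 natrX exprS; field; rewrite expf_neq0.
  have -> : (\sum_(k <oo) (C / (2 ^ (k + 1))%:R)%:E = (C / 2 ^+ 0)%:E)%E.
    by apply/cvg_lim => //; exact: cvg_geometric_eseries_half.
  exact: ltry.
have aeN : {ae lam, forall y, ~ lim_sup_set (fun k => U k `|` V k) y}.
  exists (lim_sup_set (fun k => U k `|` V k)); split => //.
    by apply: bigcap_measurable => // k _; exact: bigcup_measurable.
  by move=> y /= /contrapT.
have aeh : {ae lam, forall y, forall k, gexp y s (h k) @[s --> 0^'+] --> h k y}.
  by apply: ae_foralln => k; case: (Fc (m k)).
apply: filterS2 aeN aeh => y yN yh.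
have [N yUV] : exists N, forall k, (N <= k)%N -> ~ (U k `|` V k) y.
  apply: contrapT => /forallNP H; apply: yN => N _.
  have /existsNP[k /not_implyP[Nk /contrapT yk]] := H N.
  by exists k.
have [K K0 HK] := gexp_maximal y.
have g0 : 0 < gauss c b y by exact: gauss_gt0.
apply/cvgrPdist_le => e e0.
have e3 : 0 < e / 3 by rewrite divr_gt0.
have [k1 Hk1] := half_pow_lt (divr_gt0 e3 K0).
have [k2 Hk2] := half_pow_lt (mulr_gt0 e3 g0).
(* One index serves three purposes: [y] lies outside [U k] and [V k], the averages of [d k] are at
   most [e / 3], and so is [d k y]. Only then is the width [s] sent to 0, for this fixed [k]. *)
pose k := maxn N (maxn k1 k2).
have {}Hk1 : 2 ^- k < e / 3 / K by apply: Hk1; rewrite /k leq_max leq_max leqnn orbT.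
have {}Hk2 : 2 ^- k < e / 3 * gauss c b y by apply: Hk2; rewrite /k leq_max leq_max leqnn !orbT.
have yk : ~ (U k `|` V k) y by apply: yUV; rewrite leq_max leqnn.
have dk s : 0 < s -> s *+ 2 <= b -> gexp y s (d k) <= e / 3.
  move=> s0 sb; apply: (@le_trans _ _ (K * 2 ^- k)); last first.
    by rewrite mulrC -ler_pdivlMr// ltW.
  apply: HK => //.
  move=> r r0; rewrite leNgt; apply/negP => lt; apply: yk; left.
  by have [_ + _] := UP k; apply; first exact: r0; exact: lt.
have dy : d k y <= e / 3.
  have : p k y < 2 ^- k by rewrite ltNge; apply/negP => le; apply: yk; right.
  by move=> /lt_trans/(_ Hk2); rewrite /p ltr_pM2r// => /ltW.
have /cvgrPdist_le/(_ _ e3) hk := yh k.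
near=> s.
have s0 : 0 < s by near: s; exact: nbhs_right_gt.
have sb2 : s < b / 2 by near: s; apply: nbhs_right_lt; rewrite divr_gt0.
have sb : s *+ 2 <= b by rewrite -mulr_natr -ler_pdivlMr// ltW.
have sb' : s < b by apply: (lt_trans sb2); rewrite ltr_pdivrMr// ltr_pMr// ltr1n.
have H1 : `|h k y - gexp y s (h k)| <= e / 3 by near: s.
have H2 : `|gexp y s (h k) - gexp y s f| <= e / 3.
  apply: le_trans (dk s s0 sb); apply: gexp_dist.
    exact: (gint_wider y s0 sb' (hi k)).
  exact: (gint_wider y s0 sb' fi).
have H3 : `|f y - h k y| <= e / 3 by rewrite distrC.
have -> : f y - gexp y s f = (f y - h k y) + (h k y - gexp y s (h k)) + (gexp y s (h k) - gexp y s f).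
  by ring.
apply: (le_trans (ler_normD _ _)).
have := ler_normD (f y - h k y) (h k y - gexp y s (h k)).
by lra.
Unshelve. all: by end_near. Qed.

(** * From orthants to all integrable functions *)

Definition orthant (t : 'I_n -> R) : set vec := rect (fun i => `]-oo, t i[%classic).

Lemma measurable_orthant t : measurable (orthant t).
Proof. by apply: measurable_rect. Qed.

(** A half-space is the union of orthants whose bounds in the other coordinates tend to infinity, so
    orthants generate the cylinders. *)
Lemma measurable_orthantE : @measurable _ vec = <<s [set orthant t | t in setT] >>.
Proof.
apply/seteqP; split; last first.
  apply: smallest_sub; first exact: sigma_algebra_measurable.
  by move=> _ [t _ <-]; exact: measurable_orthant.
set G := [set orthant t | t in setT].
have coordG (i : 'I_n) (A : set R) : measurable A -> <<s G >> ((fun x : vec => x ord0 i) @^-1` A).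
  move=> mA; suff : preimage_set_system setT (fun x : vec => x ord0 i)
      ((@RGenInftyO.G R).-sigma.-measurable) `<=` <<s G >>.
    apply; exists A; last by rewrite setTI.
    by rewrite -RGenInftyO.measurableE.
  rewrite -g_sigma_preimageE; apply: smallest_sub; first exact: smallest_sigma_algebra.
  move=> _ [_ [t ->] <-]; rewrite setTI.
  have -> : (fun x : vec => x ord0 i) @^-1` `]-oo, t[%classic =
      \bigcup_k orthant (fun j => if j == i then t else k%:R).
    apply/seteqP; split => x /=; last first.
      by move=> [k _ /(_ i)]; rewrite eqxx.
    rewrite in_itv/= => xt.
    have kk k : k%:R < k.+1%:R :> R by rewrite ltr_nat.
    have : (\bigcup_k cube 0 k%:R) x by rewrite bigcup_cube.
    (* The cube contains its upper faces whereas the orthant is open, hence [k.+1]. *)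
    move=> [k _ xk]; exists k.+1 => // j; rewrite /= in_itv/=.
    case: eqP => [->//|_]; have := xk j; rewrite /= in_itv/= mxE !add0r => /andP[_ xkk].
    exact: (le_lt_trans xkk (kk k)).
  by apply: sigma_algebra_bigcup => k; apply: sub_sigma_algebra; eexists.
rewrite measurable_rVE; apply: smallest_sub; first exact: smallest_sigma_algebra.
move=> _ [A mA <-].
have -> : rect A = \big[setI/setT]_(i < n) (fun x : vec => x ord0 i) @^-1` A i.
  rewrite -bigcap_seq; apply/seteqP; split => x /= H i; first by move=> _; exact: H.
  by apply: (H i); rewrite /= mem_index_enum.
pose T := g_sigma_algebraType G.
apply: (@bigsetI_measurable _ T) => i _; apply: coordG; exact: (mA i).1.
Qed.

Lemma orthantI t u : orthant t `&` orthant u = orthant (fun i => Num.min (t i) (u i)).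
Proof.
rewrite /orthant rectI; congr rect; apply/funext => i; apply/seteqP; split => r /=;
by rewrite !in_itv/= lt_min => /andP.
Qed.

(** Within each cube the hyperplane lies in a rectangle with one side of length zero. *)
Lemma hyperplane_null (i : 'I_n) (t : R) : lam.-negligible [set x : vec | x ord0 i = t].
Proof.
pose B k j := if j == i then [set t] else `]- k%:R, k%:R]%classic : set R.
have -> : [set x : vec | x ord0 i = t] = \bigcup_k ([set x : vec | x ord0 i = t] `&` cube 0 k%:R).
  by rewrite -setI_bigcupr bigcup_cube setIT.
apply: negligible_bigcup => k; exists (rect (B k)); split.
- by apply: measurable_rect => j; rewrite /B; case: ifP.
- rewrite (lam_rect lamP).
  + by rewrite (bigD1 i)//= /B eqxx lebesgue_measure_set1 mul0r.
  + by move=> j; rewrite /B; case: ifP.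
  + move=> j; rewrite /B; case: ifP => _; first by rewrite lebesgue_measure_set1 ltry.
    by rewrite lebesgue_measure_itv/=; case: ifP; rewrite ltry.
- move=> x [/= xt xk] j; rewrite /B; case: eqP => [->//|_].
  by have := xk j; rewrite mxE sub0r add0r.
Qed.

(** Almost every [y] lies on none of the hyperplanes [x_i = t_i], and then the indicator is constant
    near [y]. As in Chebyshev's inequality, [|1(y) - 1(x)| <= D^2 |x - y|^2], whose Gaussian mean
    [D^2 n s^2] tends to 0. *)
Lemma ae_cvg_orthant t : ae_cvg (\1_(orthant t)).
Proof.
have fi y s : 0 < s -> gint y s (\1_(orthant t)).
  by move=> s0; apply: gint_indic => //; exact: measurable_orthant.
split; first exact: fi.
have : {ae lam, forall y : vec, forall i : 'I_n, y ord0 i != t i}.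
  suff : lam.-negligible (\bigcup_(i in [set: 'I_n]) [set x : vec | x ord0 i = t i]).
    apply: negligibleS => y /= /existsNP[i /negP/negPn/eqP yi].
    by exists i.
  have -> : \bigcup_(i in [set: 'I_n]) [set x : vec | x ord0 i = t i] =
      \big[setU/set0]_(i <- index_enum 'I_n) [set x : vec | x ord0 i = t i].
    by rewrite -bigcup_seq; apply/seteqP; split => x [i _ xi]; exists i => //=; rewrite mem_index_enum.
  elim: (index_enum _) => [|i r IH]; first by rewrite big_nil; exact: negligible_set0.
  by rewrite big_cons; apply: negligibleU => //; exact: hyperplane_null.
apply: filterS => y yt.
(* [D^-1] is at most each [|y_i - t_i|]; the summand 1 keeps [D] positive in dimension 0. *)
pose D := 1 + \sum_(i < n) `|y ord0 i - t i|^-1.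
have D0 : 0 < D by rewrite ltr_pwDl// sumr_ge0.
have far x : `|\1_(orthant t) y - \1_(orthant t) x| <= D ^+ 2 * sqnorm (x - y) :> R.
  have [near|/existsNP[i /negP]] := pselect (forall i, `|x ord0 i - y ord0 i| < D^-1).
    have -> : \1_(orthant t) y = \1_(orthant t) x :> R.
      rewrite !indicE; congr (_ %:R); congr nat_of_bool; apply/idP/idP => /set_mem H; apply/mem_set => i.
        have := H i; have := near i; have := yt i; rewrite /= !in_itv/= => yti xyi lt.
        have : D^-1 <= `|y ord0 i - t i|.
          rewrite -[leRHS]invrK lef_pV2 ?posrE ?invr_gt0 ?normr_gt0 ?subr_eq0//.
          by rewrite /D (bigD1 i)//= addrCA lerDl addr_ge0// sumr_ge0.
        by move: xyi; rewrite ltr_norml ltr0_norm ?subr_lt0// => /andP[? ?]; lra.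
      have := H i; have := near i; have := yt i; rewrite /= !in_itv/= => yti xyi lt.
      have : D^-1 <= `|y ord0 i - t i|.
        rewrite -[leRHS]invrK lef_pV2 ?posrE ?invr_gt0 ?normr_gt0 ?subr_eq0//.
        by rewrite /D (bigD1 i)//= addrCA lerDl addr_ge0// sumr_ge0.
      rewrite ltNge; apply/contraPN => ty; rewrite ger0_norm ?subr_ge0//.
      by move: xyi; rewrite ltr_norml => /andP[? ?]; lra.
    by rewrite subrr normr0 mulr_ge0 ?sqr_ge0 ?sqnorm_ge0.
  rewrite -leNgt => xi; apply: (@le_trans _ _ 1).
    by rewrite !indicE; case: (_ \in _); case: (_ \in _); rewrite ?subrr ?subr0 ?sub0r ?normrN ?normr0 ?normr1.
  have D1 : 0 < D^-1 by rewrite invr_gt0.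
  rewrite -ler_pdivrMl ?exprn_gt0// mulr1 -exprVn.
  apply: (le_trans _ (coord_sqr_le (x - y) i)); rewrite !mxE -[leRHS]real_normK ?num_real//.
  by rewrite lerXn2r ?nnegrE// ltW.
apply/cvgrPdist_le => e e0.
have E0 : 0 < D ^+ 2 * n%:R + 1 by rewrite ltr_wpDl// mulr_ge0// sqr_ge0.
near=> s.
have s0 : 0 < s by near: s; exact: nbhs_right_gt.
have qi := gint_sqnorm lamP y s0.
rewrite -[X in `|X - _|](gexp_cst lamP y _ s0).
have ci := gint_cst lamP y (\1_(orthant t) y) s0.
apply: (le_trans (gexp_dist ci (fi y s s0))).
apply: (@le_trans _ _ (gexp y s (fun x => D ^+ 2 * sqnorm (x - y)))).
  by apply: le_gexp => //; [apply: gint_abs; apply: gintB => //; exact: fi|exact: gintZ].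
rewrite gexpZ// (gexp_sqnorm lamP)//.
have s1 : s < Num.min 1 (e / (D ^+ 2 * n%:R + 1)).
  by near: s; apply: nbhs_right_lt; rewrite lt_min ltr01 divr_gt0.
move: s1; rewrite lt_min => /andP[s1]; rewrite ltr_pdivlMr// => se.
have ss : s ^+ 2 <= s by rewrite expr2 ler_piMr// ltW.
rewrite mulrA; apply: (@le_trans _ _ (D ^+ 2 * n%:R * s)).
  by rewrite ler_wpM2l// mulr_ge0// sqr_ge0.
by move: se; rewrite mulrDr mulr1 mulrC => se; lra.
Unshelve. all: by end_near. Qed.

Lemma gexp_indic (S : set vec) : measurable S ->
  gexp c b (\1_S : vec -> R) =
  fine (density_measure lam (gauss_ge0 c b) (measurable_gauss c b) S).
Proof.
move=> mS; rewrite /gexp; congr fine; rewrite [RHS]integral_mkcond.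
apply: eq_integral => x _; rewrite patchE indicE; case: ifP => _; by rewrite ?mul1r ?mul0r.
Qed.

(** Dynkin induction from the orthants, a pi-system: complements by linearity, countable disjoint
    unions by [ae_cvg_lim], since the finite unions converge in mean by continuity from below of the
    Gaussian measure. *)
Lemma ae_cvg_indic (S : set vec) : measurable S -> ae_cvg (\1_S).
Proof.
move=> mS; have : <<s [set orthant t | t in setT] >> S by rewrite -measurable_orthantE.
move: S {mS}; apply: (dynkin_induction (P := fun S => ae_cvg (\1_S))).
- exact: measurable_orthantE.
- by move=> _ _ [t _ <-] [u _ <-]; rewrite orthantI; eexists.
- by have := ae_cvg_cst 1; congr ae_cvg; apply/funext => x; rewrite indicT.
- by move=> _ [t _ <-]; exact: ae_cvg_orthant.
- move=> S mS HS; have := ae_cvgD (ae_cvg_cst 1) (ae_cvgZ (-1) HS).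
  congr ae_cvg; apply/funext => x; rewrite !indicE in_setC /=.
  by case: (_ \in _); rewrite /= ?mulr1 ?mulr0 ?addr0 ?subrr.
- move=> F mF tF HF.
  have mU : measurable (\bigcup_k F k) by exact: bigcupT_measurable.
  have mUk k : measurable (\big[setU/set0]_(i < k) F i) by exact: bigsetU_measurable.
  have Hk k : ae_cvg (\1_(\big[setU/set0]_(i < k) F i)).
    elim: k => [|k IH].
      by have := ae_cvg_cst 0; congr ae_cvg; apply/funext => x; rewrite big_ord0 indic0.
    have := ae_cvgD IH (HF k); congr ae_cvg; apply/funext => x.
    rewrite big_ord_recr/= !indicE in_setU.
    case: (boolP (x \in F k)) => [xk|_]; last by rewrite orbF addr0.
    have /negbTE-> : x \notin \big[setU/set0]_(i < k) F i.
      apply/negP => /set_mem; rewrite -bigcup_mkord => -[i /= ik Fi].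
      have := tF i k I I; move=> /(_ (ex_intro _ x (conj Fi (set_mem xk)))) ki.
      by rewrite ki ltnn in ik.
    by rewrite add0r.
  have Ui := gint_indic c b0 mU.
  apply: (ae_cvg_lim Hk) => //.
  pose mB := density_measure lam (gauss_ge0 c b) (measurable_gauss c b).
  have mBfin S : measurable S -> mB S \is a fin_num.
    move=> mS; rewrite ge0_fin_numE//; apply: (@le_lt_trans _ _ (mB setT)).
      by apply: le_measure; rewrite ?inE.
    by rewrite /mB /density_measure (integral_gauss lamP)// ltry.
  have E k : gexp c b (fun x => `|\1_(\big[setU/set0]_(i < k) F i) x - \1_(\bigcup_k F k) x|) =
     fine (mB (\bigcup_k F k)) - fine (mB (\big[setU/set0]_(i < k) F i)).
    rewrite -!gexp_indic// -gexpB//; last by apply: gint_indic.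
    congr gexp; apply/funext => x; rewrite distrC ger0_norm// subr_ge0 !indicE ler_nat.
    case: (boolP (x \in \big[setU/set0]_(i < k) F i)) => // /set_mem.
    rewrite -bigcup_mkord => -[i _ Fi]; rewrite mem_set//; by exists i.
  under eq_fun do rewrite E.
  suff : fine (mB (\bigcup_k F k)) - fine (mB (\big[setU/set0]_(i < k) F i)) @[k --> \oo] -->
    fine (mB (\bigcup_k F k)) - fine (mB (\bigcup_k F k)) by rewrite subrr.
  apply: cvgB; first exact: cvg_cst.
  apply: fine_cvg; rewrite fineK ?mBfin//.
  have -> : \bigcup_k F k = \bigcup_k \big[setU/set0]_(i < k) F i.
    apply/seteqP; split => x [k _ xk].
      by exists k.+1 => //; rewrite -bigcup_mkord; exists k => /=.
    by move: xk; rewrite -bigcup_mkord => -[i _ Fi]; exists i.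
  apply: (nondecreasing_cvg_mu (mu := mB)) => //; first exact: bigcupT_measurable.
  move=> i j ij; apply/subsetPset; rewrite -!bigcup_mkord => x [l /= li Fl].
  by exists l => //=; exact: leq_trans ij.
Qed.

Import HBSimple.

(** Simple functions are dense in the L^1 space of N(c, b^2 I), and [ae_cvg_lim] asks for
    approximation in exactly that norm. *)
Lemma gauss_ae_cvg (f : vec -> R) : gint c b f -> ae_cvg f.
Proof.
move=> fi; have [mf intf] := fi.
pose mB := density_measure lam (gauss_ge0 c b) (measurable_gauss c b).
have mBE S : measurable S -> mB S = (\int[lam]_(x in S) (gauss c b x)%:E)%E by [].
have := (integrable_density (gauss_ge0 c b) (measurable_gauss c b) mBE mf).2 intf.
move=> /(approximation_sfun_integrable measurableT)[g [gi _ gf]].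
have gc k : ae_cvg (g k).
  have [N [r gE]] : exists N (r : nat -> R), forall x,
      g k x = \sum_(i < N) r i * \1_(g k @^-1` [set r i]) x.
    by eexists; eexists => x; exact: fimfunEord.
  have -> : (g k : vec -> R) = (fun x => \sum_(i < N) r i * \1_(g k @^-1` [set r i]) x).
    exact/funext.
  by apply: ae_cvg_sum => y; apply: ae_cvgZ; apply: ae_cvg_indic.
apply: (ae_cvg_lim gc fi).
move: gf => /fine_cvg; apply: cvg_trans; apply: near_eq_cvg; near=> k.
have [mg _] := (gc k).1.
have mD : measurable_fun setT (fun x => `|(f x)%:E - (g k x)%:E|%E).
  by apply: measurableT_comp => //; apply/measurable_EFinP; exact: measurable_funB.
have D0 x : (0 <= `|(f x)%:E - (g k x)%:E|)%E by exact: abse_ge0.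
rewrite /gexp /=; congr fine.
rewrite (@ge0_integral_density_measure _ _ _ lam _ _ _ _ mD D0).
by apply: eq_integral => x _; rewrite -EFinM distrC.
Unshelve. all: by end_near. Qed.

End ae_convergence.

(** * Stein's identity *)

Section stein.
Context {R : realType} {n : nat}.
Local Notation vec := 'rV[R]_n.

(** Serves the squared positive part, where the case split at the kink is harmless for a bound with
    remainder [h^2], and the squared distance along a line. *)
Lemma is_derive_quadratic (V : normedModType R) (f : V -> R) (x v : V) (d C : R) :
  (forall h, `|f (h *: v + x) - f x - h * d| <= C * h ^+ 2) -> is_derive x v f d.
Proof.
move=> H; have C0 : 0 <= C.
  by have := H 1; rewrite expr1n mulr1; apply: le_trans.
suff cv : h^-1 *: ((f \o shift x) (h *: v) - f x) @[h --> 0^'] --> d.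
  by apply: DeriveDef; [apply/cvg_ex; exists d|exact: cvg_lim].
apply/cvgrPdist_le => e e0; near=> h.
have h0 : h != 0 by near: h; exact: nbhs_dnbhs_neq.
have hC : C * `|h| <= e.
  have : `|h| < e / (C + 1).
    by near: h; apply: dnbhs0_lt; rewrite divr_gt0// ltr_wpDl.
  rewrite ltr_pdivlMr ?ltr_wpDl// => /ltW; apply: le_trans.
  by rewrite mulrDr mulr1 mulrC lerDl.
have -> : d - h^-1 *: ((f \o shift x) (h *: v) - f x) =
    - (h^-1 * (f (h *: v + x) - f x - h * d)).
  by rewrite /= /GRing.scale/=; field.
rewrite normrN normrM normfV ler_pdivrMl ?normr_gt0//.
by rewrite (le_trans (H h))// -real_normK ?num_real// expr2 mulrA mulrC ler_wpM2l.
Unshelve. all: by end_near. Qed.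

Lemma is_derive_sqr_max0 (x : R) :
  is_derive x 1 (fun t => Num.max t 0 ^+ 2) (2 * Num.max x 0).
Proof.
apply: (@is_derive_quadratic R^o _ _ _ _ 1) => h; rewrite mul1r /GRing.scale/= mulr1.
case: (leP x 0) => x0; case: (leP (h + x) 0) => hx0; rewrite ler_norml; apply/andP; split; nra.
Qed.

Lemma sqnorm_line (m x : vec) (j : 'I_n) (h : R) :
  sqnorm (h *: delta_mx 0 j + x - m) =
  sqnorm (x - m) + 2 * h * (x ord0 j - m ord0 j) + h ^+ 2.
Proof.
rewrite /sqnorm (bigD1 j)//= [in RHS](bigD1 j)//= !mxE !eqxx mulr1.
rewrite (eq_bigr (fun i => (x - m) ord0 i ^+ 2)); first by ring.
by move=> i /negbTE ij; rewrite !mxE ij !andbF mulr0 add0r.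
Qed.

Variables (k s : R).
Hypotheses (k0 : 0 < k) (s0 : 0 < s).

(* The [C^1] cutoff [max (1 - q / k, 0) ^ 2] of the Gaussian, as a function of the
   squared distance [q] to the center. *)
Definition cutoff (u : R) : R := Num.max (1 - u / k) 0 ^+ 2.
Definition dcutoff (u : R) : R := - (2 / k) * Num.max (1 - u / k) 0.
(** The normalizing constant of the Gaussian is left out here and restored as [p] in Stein's
    identity. *)
Definition profile (u : R) : R := cutoff u * expR (- u / (s ^+ 2 *+ 2)).
Definition dprofile (u : R) : R :=
  (dcutoff u - cutoff u / (s ^+ 2 *+ 2)) * expR (- u / (s ^+ 2 *+ 2)).

Lemma is_derive_profile (u : R) : is_derive u 1 profile (dprofile u).
Proof.
have d1 : is_derive u 1 (fun t : R => 1 - t / k) (- k^-1).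
  have -> : (fun t : R => 1 - t / k) = (cst 1 - (k^-1 \*: (@id R)) : R -> R).
    by apply/funext => t; rewrite !fctE /= /GRing.scale/= mulrC.
  by apply: is_derive_eq; rewrite /GRing.scale/= mulr1 sub0r.
have d2 : is_derive u 1 cutoff (dcutoff u).
  have := @is_derive1_comp R (fun t => Num.max t 0 ^+ 2) (fun t => 1 - t / k) u _ _
    (is_derive_sqr_max0 (1 - u / k)) d1.
  move=> H; apply: is_derive_eq H _; rewrite /dcutoff /GRing.scale/=; ring.
have d3 : is_derive u 1 (fun t : R => - t / (s ^+ 2 *+ 2)) (- (s ^+ 2 *+ 2)^-1).
  have -> : (fun t : R => - t / (s ^+ 2 *+ 2)) = ((- (s ^+ 2 *+ 2)^-1) \*: (@id R) : R -> R).
    by apply/funext => t; rewrite /= /GRing.scale/= mulrC mulrN mulNr.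
  by apply: is_derive_eq; rewrite /GRing.scale/= mulr1.
have d4 : is_derive u 1 (fun t : R => expR (- t / (s ^+ 2 *+ 2)))
    (- (s ^+ 2 *+ 2)^-1 * expR (- u / (s ^+ 2 *+ 2))).
  have := @is_derive1_comp R (@expR R) (fun t => - t / (s ^+ 2 *+ 2)) u _ _
    (is_derive_expR (- u / (s ^+ 2 *+ 2))) d3.
  by move=> H; apply: is_derive_eq H _; rewrite /GRing.scale/= mulrC.
have := @is_deriveM R R cutoff (fun t : R => expR (- t / (s ^+ 2 *+ 2))) u 1 _ _ d2 d4.
move=> H; apply: is_derive_eq H _; rewrite /dprofile /GRing.scale/=; ring.
Qed.

(** Along [e_j] the squared distance is the polynomial [L h = q + 2 h z + h^2], so the directional
    difference quotient is that of [profile \o L] at 0 and the one-variable chain rule applies. *)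
Lemma is_derive_profile_sqnorm (m x : vec) (j : 'I_n) :
  is_derive x (delta_mx 0 j) (fun x => profile (sqnorm (x - m)))
    (2 * (x ord0 j - m ord0 j) * dprofile (sqnorm (x - m))).
Proof.
set z := x ord0 j - m ord0 j; set q := sqnorm (x - m).
pose L (h : R) := q + 2 * h * z + h ^+ 2.
have dL : is_derive (0 : R) 1 L (2 * z).
  apply: (@is_derive_quadratic R^o _ _ _ _ 1) => h.
  rewrite mul1r /L /GRing.scale/= mulr1 addr0 expr0n/= mulr0 mul0r !addr0.
  by rewrite (_ : _ - _ = h ^+ 2); [rewrite ger0_norm ?sqr_ge0|ring].
have L0 : L 0 = q by rewrite /L mulr0 mul0r expr0n/= !addr0.
have dPL : is_derive (0 : R) 1 (profile \o L) (2 * z * dprofile q).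
  have dp : is_derive (L 0) 1 profile (dprofile q) by rewrite L0; exact: is_derive_profile.
  have := @is_derive1_comp R profile L 0 _ _ dp dL.
  by move=> H; apply: is_derive_eq H _; rewrite /GRing.scale/= mulrC.
have E : (fun h : R => h^-1 *: (((profile \o L) \o shift 0) (h *: 1) - (profile \o L) 0)) =
    (fun h : R => h^-1 *: (((fun x => profile (sqnorm (x - m))) \o shift x) (h *: delta_mx 0 j)
       - profile (sqnorm (x - m)))).
  apply/funext => h; rewrite /= L0 /L sqnorm_line addr0.
  by rewrite [h *: 1]mulr1.
apply: DeriveDef.
  by have := @ex_derive _ _ _ _ _ _ _ dPL; rewrite /derivable E.
by have := @derive_val _ _ _ _ _ _ _ dPL; rewrite /derive E.
Qed.

Lemma cvg_coordB (m x : vec) (i : 'I_n) :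
  (fun t : vec => t ord0 i - m ord0 i) @ x --> x ord0 i - m ord0 i.
Proof.
have c : (fun t : vec => t ord0 i) @ x --> x ord0 i by exact: coord_continuous.
exact: (@cvgB _ _ _ _ _ (fun t : vec => t ord0 i) (cst (m ord0 i)) _ _ c (cvg_cst _)).
Qed.

Lemma continuous_sqnormB (m : vec) : continuous (fun x : vec => sqnorm (x - m)).
Proof.
have -> : (fun x : vec => sqnorm (x - m)) =
    (fun x : vec => \sum_(i < n) (x ord0 i - m ord0 i) * (x ord0 i - m ord0 i)).
  by apply/funext => x; apply: eq_bigr => i _; rewrite !mxE expr2.
move=> x; suff H r : (fun t : vec => \sum_(i <- r) (t ord0 i - m ord0 i) * (t ord0 i - m ord0 i)) @ x -->
    \sum_(i <- r) (x ord0 i - m ord0 i) * (x ord0 i - m ord0 i) by exact: H.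
elim: r => [|i r IH].
  by under eq_fun do rewrite big_nil; rewrite big_nil; exact: (@cvg_cst R 0 vec (nbhs x) _).
under eq_fun do rewrite big_cons; rewrite big_cons.
have c2 : (fun t : vec => (t ord0 i - m ord0 i) * (t ord0 i - m ord0 i)) @ x -->
    (x ord0 i - m ord0 i) * (x ord0 i - m ord0 i).
  exact: (@cvgM _ _ _ _ (fun t : vec => t ord0 i - m ord0 i) (fun t : vec => t ord0 i - m ord0 i)
    _ _ (@cvg_coordB m x i) (@cvg_coordB m x i)).
exact: (@cvgD _ _ _ _ _ (fun t : vec => (t ord0 i - m ord0 i) * (t ord0 i - m ord0 i))
  (fun t : vec => \sum_(i <- r) (t ord0 i - m ord0 i) * (t ord0 i - m ord0 i)) _ _ c2 IH).
Qed.

Lemma continuous_dprofile : continuous dprofile.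
Proof.
have cm (u : R) : Num.max (1 - t / k) 0 @[t --> u] --> Num.max (1 - u / k) 0.
  apply: (@continuous_max R R (fun u => 1 - u / k) (fun=> 0)); last exact: cst_continuous.
  by apply: cvgB; [exact: cvg_cst|apply: cvgM; [exact: cvg_id|exact: cvg_cst]].
move=> u; rewrite /continuous_at /dprofile; apply: cvgM; last first.
  apply: (@continuous_cvg _ _ _ _ _ _ (@expR R)); first exact: continuous_expR.
  by apply: cvgM; [apply: cvgN; exact: cvg_id|exact: cvg_cst].
apply: cvgB; first by apply: cvgM; [exact: cvg_cst|exact: cm].
apply: cvgM; last exact: cvg_cst.
by rewrite /cutoff expr2; under eq_fun do rewrite expr2; apply: cvgM; exact: cm.
Qed.

(** The cutoff vanishes once [|x - m|^2 >= k]; the half-side [k + 1] avoids a square root, as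
    [k < (k + 1)^2]. *)
Lemma profile_support (m : vec) :
  [set x : vec | profile (sqnorm (x - m)) != 0] `<=`
  [set x : vec | forall i, `[m ord0 i - (k + 1), m ord0 i + (k + 1)]%classic (x ord0 i)].
Proof.
move=> x /=; rewrite /profile /cutoff => px i.
have q : sqnorm (x - m) < k.
  rewrite ltNge; apply/negP => kq; move/eqP: px; apply.
  have -> : Num.max (1 - sqnorm (x - m) / k) 0 = 0.
    by apply/max_idPr; rewrite subr_le0 ler_pdivlMr// mul1r.
  by rewrite expr0n/= mul0r.
have := coord_sqr_le (x - m) i; rewrite !mxE => H.
have {}H : (x ord0 i - m ord0 i) ^+ 2 < k by exact: le_lt_trans q.
have : `|x ord0 i - m ord0 i| < k + 1.
  rewrite ltNge; apply/negP => ka; have : (k + 1) ^+ 2 <= (x ord0 i - m ord0 i) ^+ 2.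
    by rewrite -[leRHS]real_normK ?num_real// lerXn2r ?nnegrE// addr_ge0// ltW.
  by rewrite leNgt => /negP; apply; apply: (lt_trans H); rewrite expr2; have := k0; nra.
by rewrite ltr_norml in_itv/= => /andP[? ?]; apply/andP; split; lra.
Qed.

Lemma test_fun_profile (m : vec) : test_fun (fun x => profile (sqnorm (x - m))).
Proof.
split.
  pose K := [set x : vec | forall i, `[m ord0 i - (k + 1), m ord0 i + (k + 1)]%classic (x ord0 i)].
  have cK : compact K.
    by apply: (@rV_compact R n (fun i => `[m ord0 i - (k + 1), m ord0 i + (k + 1)]%classic)) => i; exact: segment_compact.
  apply: (subclosed_compact _ cK); first exact: closed_closure.
  have clK : closed K by apply: compact_closed => //; exact: norm_hausdorff.
  rewrite (closure_id K).1//; apply: closureS; exact: profile_support.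
move=> j; split=> x; have dx := is_derive_profile_sqnorm m x j.
  exact: ex_derive.
have -> : (fun x0 => 'D_(delta_mx 0 j) (fun x1 => profile (sqnorm (x1 - m))) x0) =
  (fun x0 => 2 * (x0 ord0 j - m ord0 j) * dprofile (sqnorm (x0 - m))).
  by apply/funext => t; exact: (@derive_val _ _ _ _ _ _ _ (is_derive_profile_sqnorm m t j)).
have c1 : (fun t : vec => 2 * (t ord0 j - m ord0 j)) @ x --> 2 * (x ord0 j - m ord0 j).
  exact: (@cvgM _ _ _ _ (cst 2) (fun t : vec => t ord0 j - m ord0 j) _ _ (cvg_cst _) (@cvg_coordB m x j)).
have c2 : (fun t : vec => dprofile (sqnorm (t - m))) @ x --> dprofile (sqnorm (x - m)).
  exact: (cvg_comp _ _ (@continuous_sqnormB m x) (@continuous_dprofile (sqnorm (x - m)))).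
exact: (@cvgM _ _ _ _ (fun t : vec => 2 * (t ord0 j - m ord0 j))
  (fun t : vec => dprofile (sqnorm (t - m))) _ _ c1 c2).
Qed.

End stein.

Section stein_identity.
Context {R : realType} {n : nat}.
Local Notation vec := 'rV[R]_n.
Variables (lam : {measure set vec -> \bar R}) (lamP : is_lebesgue_rV lam).
Local Notation gint := (gint lam).
Local Notation gexp := (gexp lam).

(** Integrability over compact sets contains measurability there, and countably many closed cubes
    exhaust the space. *)
Lemma weak_partial_measurable (i : 'I_n) (f v : vec -> R) : weak_partial lam i f v ->
  measurable_fun setT f /\ measurable_fun setT v.
Proof.
move=> [wi _].
pose K (j : nat) := [set x : vec | forall i, `[- j%:R, j%:R]%classic (x ord0 i) : Prop].
have cK j : compact (K j).
  by apply: (@rV_compact R n (fun _ => `[- j%:R, j%:R]%classic)) => l; exact: segment_compact.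
have mK j : measurable (K j).
  by apply: (@measurable_rect R n (fun _ => `[- j%:R, j%:R]%classic)).
have KT : \bigcup_j K j = setT.
  apply/seteqP; split => // x _.
  have : (\bigcup_j cube 0 j%:R) x by rewrite bigcup_cube.
  move=> [j _ xj]; exists j => // l; have := xj l.
  by rewrite /= !in_itv/= mxE sub0r add0r => /andP[/ltW -> ->].
by split; rewrite -KT; apply/measurable_fun_bigcup => // j; apply/measurable_EFinP;
  have [fi vi] := wi _ (cK j); [exact: measurable_int fi|exact: measurable_int vi].
Qed.

Lemma gexp_dominated_cvg m s (F : nat -> vec -> R) (f G : vec -> R) :
  (forall k, measurable_fun setT (F k)) -> measurable_fun setT f -> gint m s G ->
  (forall x, F k x @[k --> \oo] --> f x) -> (forall k x, `|F k x| <= `|G x|) ->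
  gexp m s (F k) @[k --> \oo] --> gexp m s f.
Proof.
move=> mF mf Gi Ff FG; have [mG intG] := Gi.
have mg := measurable_gauss m s.
have fi : gint m s f.
  apply: gint_le Gi _ => // x.
  have cn : `|F k x| @[k --> \oo] --> `|f x| by apply: cvg_norm.
  rewrite -(cvg_lim _ cn)//; apply: limr_le; first by apply/cvg_ex; eexists; exact: cn.
  by apply: nearW => k; exact: FG.
have Fi k : gint m s (F k) by apply: gint_le Gi _.
have mFE k : measurable_fun setT (fun x => (F k x * gauss m s x)%:E).
  by apply/measurable_EFinP; exact: measurable_funM.
have mfE : measurable_fun setT (fun x => (f x * gauss m s x)%:E).
  by apply/measurable_EFinP; exact: measurable_funM.
have cvE : {ae lam, forall x, setT x ->
    (fun k => (F k x * gauss m s x)%:E) @ \oo --> (f x * gauss m s x)%:E}.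
  apply: aeW => x _; apply: cvg_EFin; first exact: nearW.
  by apply: cvgM => //; exact: cvg_cst.
have domE : {ae lam, forall x k, setT x ->
    (`|(F k x * gauss m s x)%:E| <= `|(G x * gauss m s x)%:E|)%E}.
  by apply: aeW => x k _; rewrite lee_fin !normrM ler_wpM2r.
have [_ _] := dominated_convergence measurableT mFE mfE cvE (integrable_abse intG) domE.
rewrite gexpE// => /fine_cvg; apply: cvg_trans; apply: near_eq_cvg.
by apply: nearW => k; rewrite /= gexpE.
Qed.

Lemma stein (i : 'I_n) (f v : vec -> R) (c m : vec) (b s : R) : weak_partial lam i f v ->
  0 < s -> s < b -> gint c b (fun x => f x ^+ 2) -> gint c b v ->
  gexp m s (fun x => (x ord0 i - m ord0 i) * f x) = s ^+ 2 * gexp m s v.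
Proof.
move=> wp s0 sb f2i vi; have [mf mv] := weak_partial_measurable wp.
have b0 : 0 < b by exact: lt_trans sb.
have f2 := gint_wider m s0 sb f2i.
have vs := gint_wider m s0 sb vi.
pose z (x : vec) := x ord0 i - m ord0 i.
have mz : measurable_fun setT z by exact: measurable_coordB.
have zf : gint m s (fun x => z x * f x) by apply: gint_mul => //; exact: gint_coord_sqr.
pose k (j : nat) : R := j.+1%:R.
have k0 j : 0 < k j by rewrite ltr0n.
pose S2 := s ^+ 2 *+ 2.
have S20 : 0 < S2 by rewrite mulrn_wgt0// exprn_gt0.
pose p := normal_peak s ^+ n.
have p0 : 0 < p by rewrite exprn_gt0// normal_peak_gt0// gt_eqF.
pose q (x : vec) := sqnorm (x - m).
have mq : measurable_fun setT q by exact: measurable_sqnormB.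
have mmax j : measurable_fun setT (fun x => Num.max (1 - q x / k j) 0).
  by apply: measurable_maxr => //; apply: measurable_funB => //; exact: measurable_funM.
have mcut j : measurable_fun setT (fun x => cutoff (k j) (q x)) by exact: measurable_funX.
have mdcut j : measurable_fun setT (fun x => dcutoff (k j) (q x)) by exact: measurable_funM.
have max01 j x : 0 <= Num.max (1 - q x / k j) 0 <= 1.
  rewrite le_max lexx orbT ge_max ler01 andbT /= gerBl.
  by rewrite divr_ge0 ?sqnorm_ge0// ltW.
have cut1 j x : `|cutoff (k j) (q x)| <= 1.
  have /andP[m0 m1] := max01 j x.
  by rewrite /cutoff ger0_norm ?sqr_ge0// expr_le1.
have dcut2 j x : `|dcutoff (k j) (q x)| <= 2 / k j.
  have /andP[m0 m1] := max01 j x.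
  have k2 : 0 <= 2 / k j by rewrite divr_ge0 ?(ltW (k0 j)).
  by rewrite /dcutoff normrM normrN (ger0_norm m0) (ger0_norm k2) ler_piMr.
have kinv : (k j)^-1 @[j --> \oo] --> 0.
  by have := @cvg_harmonic R; rewrite /harmonic.
have cvgmax x : Num.max (1 - q x / k j) 0 @[j --> \oo] --> (1 : R).
  apply/cvgrPdist_le => e e0.
  have : q x / k j @[j --> \oo] --> q x * 0 by apply: cvgM => //; exact: cvg_cst.
  rewrite mulr0 => /cvgrPdist_le/(_ _ e0); apply: filterS => j; rewrite sub0r normrN => qe.
  have qk0 : 0 <= q x / k j by rewrite divr_ge0 ?sqnorm_ge0// ltW.
  rewrite ger0_norm// in qe; rewrite ger0_norm; last first.
    by rewrite subr_ge0; have /andP[] := max01 j x.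
  by rewrite lerBlDr -lerBlDl le_max lerD2l lerN2 qe.
have cvgcut x : cutoff (k j) (q x) @[j --> \oo] --> (1 : R).
  rewrite -[X in _ --> X](expr1n _ 2) /cutoff; under eq_fun do rewrite expr2.
  by rewrite expr2; apply: cvgM.
have cvgdcut x : dcutoff (k j) (q x) @[j --> \oo] --> (0 : R).
  rewrite -[X in _ --> X](mul0r (1 : R)); apply: cvgM => //.
  rewrite -[X in _ --> X]oppr0 -[X in _ --> - X](mulr0 (2 : R)).
  by apply: cvgN; apply: cvgM => //; exact: cvg_cst.
(* [A j] and [B j] are [f * D_i phi] and [v * phi] divided by the Gaussian density, up to the
   constant [p]. As [j] grows, [A j] tends to [- z f / s^2] and [B j] to [v]. *)
pose A j x := z x * f x * (2 * (dcutoff (k j) (q x) - cutoff (k j) (q x) / S2)).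
pose B j x := v x * cutoff (k j) (q x).
(* Since [k j >= 1], the cutoff's derivative is at most 2 in absolute value, so [C * |z f|]
   dominates every [A j]. The product [z f] is integrable because both squares are. *)
pose C : R := 2 * (2 + S2^-1).
have mA j : measurable_fun setT (A j).
  apply: measurable_funM; first exact: measurable_funM.
  by apply: measurable_funM => //; apply: measurable_funB => //; exact: measurable_funM.
have mB j : measurable_fun setT (B j) by exact: measurable_funM.
have Ale j x : `|A j x| <= `|C * (z x * f x)|.
  rewrite normrM [leRHS]normrM mulrC ler_wpM2r// [leRHS]ger0_norm; last first.
    by rewrite mulr_ge0// addr_ge0// invr_ge0 ltW.
  rewrite normrM ger0_norm// ler_wpM2l//.
  apply: (le_trans (ler_normB _ _)); apply: lerD.
    apply: (le_trans (dcut2 j x)); rewrite ler_pdivrMr// ler_peMr// /k ler1n//.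
  by rewrite normrM normfV (gtr0_norm S20) ler_piMl// invr_ge0 ltW.
have Ble j x : `|B j x| <= `|v x| by rewrite normrM ler_piMr.
have Ai j : gint m s (A j) by apply: (gint_le (mA j) (gintZ C zf)).
have Bi j : gint m s (B j) by apply: (gint_le (mB j) vs).
have scaleE (h : vec -> R) : gint m s h ->
    (\int[lam]_x (p^-1 * h x * gauss m s x)%:E = (p^-1 * gexp m s h)%:E)%E.
  by move=> hi; rewrite gexpE ?gexpZ//; exact: gintZ.
have key j : gexp m s (A j) = - gexp m s (B j).
  pose phi (x : vec) := profile (k j) s (sqnorm (x - m)).
  have := wp.2 phi (test_fun_profile s (k0 j) m).
  have -> : (\int[lam]_x (f x * 'D_(delta_mx 0 i) phi x)%:E = (p^-1 * gexp m s (A j))%:E)%E.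
    rewrite -scaleE//; apply: eq_integral => x _.
    rewrite (@derive_val _ _ _ _ _ _ _ (is_derive_profile_sqnorm (k j) s m x i)).
    congr EFin; rewrite /A /dprofile /gauss -/p -/(q x) -/(z x) -/S2; field.
    apply/andP; split; last by rewrite gt_eqF.
    by change (s ^+ 2 != 0); rewrite expf_neq0// gt_eqF.
  have -> : (\int[lam]_x (v x * phi x)%:E = (p^-1 * gexp m s (B j))%:E)%E.
    rewrite -scaleE//; apply: eq_integral => x _.
    congr EFin; rewrite /B /phi /profile /gauss -/p -/(q x) -/S2; field.
    by rewrite gt_eqF.
  rewrite -EFinN => /eqP; rewrite eqe => /eqP; rewrite -mulrN; apply: mulfI.
  by rewrite invr_eq0 gt_eqF.
have lim1 : gexp m s (A j) @[j --> \oo] --> gexp m s (fun x => z x * f x * (2 * (0 - 1 / S2))).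
  apply: (gexp_dominated_cvg mA _ (gintZ C zf) _ Ale).
    by apply: measurable_funM => //; exact: measurable_funM.
  move=> x; apply: cvgM; first exact: cvg_cst.
  apply: cvgM; first exact: cvg_cst.
  by apply: cvgB => //; apply: cvgM => //; exact: cvg_cst.
have lim2 : - gexp m s (B j) @[j --> \oo] --> - gexp m s (fun x => v x * 1).
  apply: cvgN; apply: (gexp_dominated_cvg mB _ vs _ Ble).
    exact: measurable_funM.
  by move=> x; apply: cvgM => //; exact: cvg_cst.
have {lim2} := lim2; under eq_fun do rewrite -key.
move=> lim2.
have e1 : limn (fun j => gexp m s (A j)) = gexp m s (fun x => z x * f x * (2 * (0 - 1 / S2))).
  exact/cvg_lim.
have e2 : limn (fun j => gexp m s (A j)) = - gexp m s (fun x => v x * 1) by exact/cvg_lim.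
have := etrans (esym e1) e2.
have -> : (fun x => v x * 1) = v by apply/funext => x; rewrite mulr1.
have -> : gexp m s (fun x => z x * f x * (2 * (0 - 1 / S2))) =
    - (s ^- 2) * gexp m s (fun x => z x * f x).
  rewrite -gexpZ//; congr gexp; apply/funext => x; rewrite /S2; field.
  by rewrite gt_eqF.
move=> /eqP; rewrite mulNr eqr_opp => /eqP H.
by rewrite -H mulrA divff ?mul1r// expf_neq0// gt_eqF.
Qed.

End stein_identity.

(** * The CB estimator and SURE *)

Section assembly.
Context {R : realType} {n : nat}.
Local Notation vec := 'rV[R]_n.

Lemma integral_image_measure (mu : {measure set vec -> \bar R}) (phi : vec -> vec)
    (mphi : measurable_fun setT phi) (f : vec -> R) : measurable_fun setT f ->
  (\int[image_measure mu mphi]_x (f x)%:E = \int[mu]_x (f (phi x))%:E)%E.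
Proof.
move=> mf; have mfE : measurable_fun setT (EFin \o f) by exact/measurable_EFinP.
rewrite integralE [RHS]integralE; congr (_ - _)%E.
- have := @ge0_integral_pushforward _ _ _ _ R _ mphi mu setT (fun x => (f x)%:E)^\+%E.
  rewrite preimage_setT => H; etransitivity; first by apply: H => //; exact: measurable_funepos.
  by apply: eq_integral => x _; rewrite /= !funeposE.
- have := @ge0_integral_pushforward _ _ _ _ R _ mphi mu setT (fun x => (f x)%:E)^\-%E.
  rewrite preimage_setT => H; etransitivity; first by apply: H => //; exact: measurable_funeneg.
  by apply: eq_integral => x _; rewrite /= !funenegE.
Qed.

Variables (lam : {measure set vec -> \bar R}) (lamP : is_lebesgue_rV lam).
Local Notation gint := (gint lam).
Local Notation gexp := (gexp lam).

Lemma normal_gint (mu : probability vec R) m s (f : vec -> R) : 0 < s -> is_normal_rV mu m s ->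
  measurable_fun setT f -> mu.-integrable setT (EFin \o f) -> gint m s f.
Proof.
move=> s0 muP mf fi; split=> //.
exact: (integrable_density (gauss_ge0 m s) (measurable_gauss m s) (normal_density lamP s0 muP) mf).1.
Qed.

Lemma normal_gexp (mu : probability vec R) m s (f : vec -> R) : 0 < s -> is_normal_rV mu m s ->
  gint m s f -> (\int[mu]_x (f x)%:E = (gexp m s f)%:E)%E.
Proof.
move=> s0 muP fi; rewrite -gexpE//.
exact: (integral_density (gauss_ge0 m s) (measurable_gauss m s) (normal_density lamP s0 muP) fi.1).
Qed.

Lemma normal_affine_gexp (mu : probability vec R) (s c : R) (y : vec) (f : vec -> R) :
  0 < s -> 0 < c -> is_normal_rV mu 0 s -> gint y (c * s) f ->
  (\int[mu]_w (f (affine y c w))%:E = (gexp y (c * s) f)%:E)%E.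
Proof.
move=> s0 c0 muP fi; rewrite -gexpE// -(integral_image_measure mu (measurable_affine y c) fi.1).
apply: (integral_density (gauss_ge0 y (c * s)) (measurable_gauss y (c * s)) _ fi.1).
by move=> A mA; exact: (normal_affine_density lamP).
Qed.

(** Absolute continuity of the normal law carries almost sure statements from [lam] to the law of
    [Y]. *)
Lemma normal_negligible (mu : probability vec R) m s (N : set vec) : 0 < s ->
  is_normal_rV mu m s -> lam.-negligible N -> mu.-negligible N.
Proof.
move=> s0 muP [A [mA A0 NA]]; exists A; split => //.
rewrite (normal_density lamP s0 muP)//; apply: null_set_integral => //.
by apply: measurable_funTS; apply/measurable_EFinP; exact: measurable_gauss.
Qed.

Lemma ae_forall_ord (P : 'I_n -> vec -> Prop) :
  (forall i, {ae lam, forall y, P i y}) -> {ae lam, forall y, forall i, P i y}.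
Proof.
move=> HP; have : {ae lam, forall y, forall k : nat, forall i : 'I_n, val i = k -> P i y}.
  apply: ae_foralln => k; have [kn|nk] := ltnP k n.
    apply: filterS (HP (Ordinal kn)) => y Py i ik.
    by have -> : i = Ordinal kn by exact: val_inj.
  by apply: aeW => y i ik; have := ltn_ord i; rewrite ltnNge -ik in nk *; rewrite nk.
by apply: filterS => y Hy i; exact: (Hy (val i)).
Qed.

Lemma cvg_sqrt_scale (s : R) : 0 < s -> Num.sqrt a * s @[a --> 0^'+] --> 0^'+.
Proof.
move=> s0 P [e /= e0 eP]; suff : \forall a \near 0^'+, P (Num.sqrt a * s) by [].
near=> a.
have a0 : 0 < a by near: a; exact: nbhs_right_gt.
have ae : a < (e / s) ^+ 2.
  by near: a; apply: nbhs_right_lt; rewrite exprn_gt0// divr_gt0.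
have sa : 0 < Num.sqrt a by rewrite sqrtr_gt0.
apply: eP; last by rewrite /= mulr_gt0.
rewrite /ball_/= sub0r normrN gtr0_norm ?mulr_gt0// -ltr_pdivlMr//.
have es : 0 <= e / s by rewrite divr_ge0// ltW.
by rewrite -(ger0_norm es) -sqrtr_sqr ltr_sqrt// exprn_gt0// divr_gt0.
Unshelve. all: by end_near. Qed.

Variables (g : vec -> vec) (dg : 'I_n -> vec -> R) (c : vec) (b sigma : R).
Hypotheses (sigma0 : 0 < sigma) (b0 : 0 < b).
Hypothesis wp : forall i : 'I_n, weak_partial lam i (fun y => g y ord0 i) (dg i).
Hypothesis g2i : forall i, gint c b (fun y => g y ord0 i ^+ 2).
Hypothesis dgi : forall i, gint c b (dg i).

Let mg i : measurable_fun setT (fun y => g y ord0 i).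
Proof. by case: (weak_partial_measurable (wp i)). Qed.

Let g2 m s i : 0 < s -> s < b -> gint m s (fun y => g y ord0 i ^+ 2).
Proof. by move=> s0 sb; exact: gint_wider (g2i i). Qed.

Let g1 m s i : 0 < s -> s < b -> gint m s (fun y => g y ord0 i).
Proof. by move=> s0 sb; exact: (gint_sqr_self lamP s0 (mg i) (g2 m i s0 sb)). Qed.

Let d1 m s i : 0 < s -> s < b -> gint m s (dg i).
Proof. by move=> s0 sb; exact: gint_wider (dgi i). Qed.

Let zg m s i : 0 < s -> s < b -> gint m s (fun y => (y ord0 i - m ord0 i) * g y ord0 i).
Proof.
move=> s0 sb.
exact: (gint_mul (measurable_coordB m i) (mg i) (gint_coord_sqr lamP m i s0) (g2 m i s0 sb)).
Qed.

Lemma CB_infE (mu0 : probability vec R) (a : R) (y : vec) : is_normal_rV mu0 0 sigma ->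
  0 < a -> Num.sqrt a * sigma < b ->
  CB_inf mu0 sigma g a y =
  (\sum_(i < n) (y ord0 i ^+ 2 - 2 * y ord0 i * gexp y (Num.sqrt a * sigma) (fun x => g x ord0 i)
     + gexp y (Num.sqrt a * sigma) (fun x => g x ord0 i ^+ 2)
     + 2 * sigma ^+ 2 * gexp y (Num.sqrt a * sigma) (dg i)) - n%:R * sigma ^+ 2)%:E.
Proof.
move=> mu0P a0 asb; set r := Num.sqrt a; set s := r * sigma.
have r0 : 0 < r by rewrite sqrtr_gt0.
have s0 : 0 < s by rewrite mulr_gt0.
have r2 : r ^+ 2 = a by rewrite sqr_sqrtr// ltW.
(* With [x = y + r w] and [r^2 = a] one has [w / r = (x - y) / a], so the cross term of the square
   becomes [- (2 / a) (x_i - y_i) (y_i - g_i x)]. Its part in [y_i] has mean zero, its part in [g_i]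
   goes to Stein's identity. *)
pose F i (x : vec) := (y ord0 i ^+ 2 + (- (2 * y ord0 i)) * g x ord0 i + g x ord0 i ^+ 2)
  + ((- (2 / a * y ord0 i)) * (x ord0 i - y ord0 i)
     + (2 / a) * ((x ord0 i - y ord0 i) * g x ord0 i)).
have f1 i : gint y s (fun x => y ord0 i ^+ 2 + (- (2 * y ord0 i)) * g x ord0 i).
  by apply: gintD; [exact: (gint_cst lamP y (y ord0 i ^+ 2))|apply: gintZ; exact: g1].
have f2 i : gint y s (fun x => (y ord0 i ^+ 2 + (- (2 * y ord0 i)) * g x ord0 i) + g x ord0 i ^+ 2).
  by apply: gintD => //; exact: g2.
have z1 i : gint y s (fun x => (- (2 / a * y ord0 i)) * (x ord0 i - y ord0 i)).
  by apply: gintZ; exact: gint_coord.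
have z2 i : gint y s (fun x => (2 / a) * ((x ord0 i - y ord0 i) * g x ord0 i)).
  by apply: gintZ; exact: zg.
have Fi i : gint y s (F i) by apply: gintD => //; exact: gintD.
have -> : CB_inf mu0 sigma g a y = ((gexp y s (fun x => \sum_(i < n) F i x))%:E - (n%:R * sigma ^+ 2)%:E)%E.
  rewrite /CB_inf; congr (_ - _)%E.
  rewrite -(normal_affine_gexp sigma0 r0 mu0P); last exact: gint_sum.
  apply: eq_integral => w _; congr EFin.
  rewrite /sqnorm mulr_suml -sumrB; apply: eq_bigr => i _.
  rewrite /F /affine !mxE -/r -r2; set G := g _ ord0 i; field.
  by rewrite gt_eqF.
rewrite -EFinB; congr (_ - _)%:E; rewrite gexp_sum//; apply: eq_bigr => i _.
rewrite gexpD//; last exact: gintD.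
rewrite gexpD//; last exact: g2.
rewrite gexpD//; [|exact: (gint_cst lamP y (y ord0 i ^+ 2))|by apply: gintZ; exact: g1].
rewrite (gexp_cst lamP y (y ord0 i ^+ 2))// gexpZ; last exact: g1.
rewrite gexpD// gexpZ; last exact: gint_coord.
rewrite gexpZ; last exact: zg.
rewrite (gexp_coord lamP)// (stein lamP y (wp i) s0 asb (g2i i) (dgi i)).
rewrite {1}/s exprMn r2; field.
by rewrite gt_eqF.
Qed.

(** The closed formula holds at every [y] once [sqrt a * sigma < b], so the exceptional set comes
    only from the limits of the averages of [g_i], [g_i^2] and [d_i g_i], and does not vary with
    [a]. *)
Lemma CB_inf_cvg (mu0 : probability vec R) : is_normal_rV mu0 0 sigma ->
  {ae lam, forall y, CB_inf mu0 sigma g a y @[a --> 0^'+] --> (SURE sigma g dg y)%:E}.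
Proof.
move=> mu0P.
have cg : {ae lam, forall y, forall i : 'I_n, gexp y s (fun x => g x ord0 i) @[s --> 0^'+] --> g y ord0 i}.
  apply: ae_forall_ord => i; apply: (gauss_ae_cvg lamP b0 _).2.
  exact: (gint_sqr_self lamP b0 (mg i) (g2i i)).
have cg2 : {ae lam, forall y, forall i : 'I_n,
    gexp y s (fun x => g x ord0 i ^+ 2) @[s --> 0^'+] --> g y ord0 i ^+ 2}.
  by apply: ae_forall_ord => i; apply: (gauss_ae_cvg lamP b0 (g2i i)).2.
have cdg : {ae lam, forall y, forall i : 'I_n, gexp y s (dg i) @[s --> 0^'+] --> dg i y}.
  by apply: ae_forall_ord => i; apply: (gauss_ae_cvg lamP b0 (dgi i)).2.
apply: filterS3 cg cg2 cdg => y cg cg2 cdg.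
pose Phi s := \sum_(i < n) (y ord0 i ^+ 2 - 2 * y ord0 i * gexp y s (fun x => g x ord0 i)
     + gexp y s (fun x => g x ord0 i ^+ 2) + 2 * sigma ^+ 2 * gexp y s (dg i)) - n%:R * sigma ^+ 2.
have cPhi : Phi s @[s --> 0^'+] --> SURE sigma g dg y.
  have -> : SURE sigma g dg y = \sum_(i < n) (y ord0 i ^+ 2 - 2 * y ord0 i * g y ord0 i
      + g y ord0 i ^+ 2 + 2 * sigma ^+ 2 * dg i y) - n%:R * sigma ^+ 2.
    rewrite /SURE /sqnorm mulr_sumr -big_split/=; congr (_ - _); apply: eq_bigr => i _.
    by rewrite !mxE; ring.
  apply: cvgB; last exact: cvg_cst.
  elim: (index_enum _) => [|i r IH]; first by under eq_fun do rewrite big_nil; rewrite big_nil; exact: cvg_cst.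
  under eq_fun do rewrite big_cons; rewrite big_cons; apply: cvgD => //.
  apply: cvgD; last by apply: cvgM => //; exact: cvg_cst.
  apply: cvgD => //; apply: cvgB; first exact: cvg_cst.
  by apply: cvgM => //; exact: cvg_cst.
have cPhi' : Phi (Num.sqrt a * sigma) @[a --> 0^'+] --> SURE sigma g dg y.
  exact: (cvg_comp _ _ (cvg_sqrt_scale sigma0) cPhi).
have : (Phi (Num.sqrt a * sigma))%:E @[a --> 0^'+] --> (SURE sigma g dg y)%:E.
  by apply: cvg_EFin => //; exact: nearW.
have near_b : \forall a \near (0 : R)^'+, Num.sqrt a * sigma < b.
  exact: (cvg_sqrt_scale sigma0 (nbhs_right_lt b0)).
apply: cvg_trans; apply: near_eq_cvg; near=> a.
have a0 : 0 < a by near: a; exact: nbhs_right_gt.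
have asb : Num.sqrt a * sigma < b by near: a; exact: near_b.
by rewrite CB_infE.
Unshelve. all: by end_near. Qed.

Lemma SURE_unbiased (mu : probability vec R) (theta : vec) : sigma < b ->
  is_normal_rV mu theta sigma ->
  (\int[mu]_y (SURE sigma g dg y)%:E = \int[mu]_y (sqnorm (theta - g y))%:E)%E.
Proof.
move=> sb muP.
pose z (i : 'I_n) (y : vec) := y ord0 i - theta ord0 i.
have zi i : gint theta sigma (z i) by exact: gint_coord.
have qi : gint theta sigma (fun y => sqnorm (y - theta)) by exact: gint_sqnorm.
pose L i (y : vec) := (theta ord0 i - g y ord0 i) ^+ 2.
have Li i : gint theta sigma (L i).
  have -> : L i = fun y => (theta ord0 i ^+ 2 + (- (2 * theta ord0 i)) * g y ord0 i) + g y ord0 i ^+ 2.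
    by apply/funext => y; rewrite /L; ring.
  apply: gintD; last exact: g2.
  by apply: gintD; [exact: (gint_cst lamP theta (theta ord0 i ^+ 2))|apply: gintZ; exact: g1].
have lossE y : sqnorm (theta - g y) = \sum_(i < n) L i y.
  by apply: eq_bigr => i _; rewrite !mxE.
have lossi : gint theta sigma (fun y => \sum_(i < n) L i y) by exact: gint_sum.
(* Expanding [y - g = (y - theta) + (theta - g)] makes SURE the loss plus
   [|y - theta|^2 - n sigma^2] plus the sum of the [M i]. The second moment cancels [n sigma^2], and
   each [M i] has mean zero by Stein's identity. *)
pose M i (y : vec) := ((-2) * (z i y * g y ord0 i) + (2 * theta ord0 i) * z i y)
  + (2 * sigma ^+ 2) * dg i y.
have m1 i : gint theta sigma (fun y => (-2) * (z i y * g y ord0 i)) by apply: gintZ; exact: zg.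
have m2 i : gint theta sigma (fun y => (2 * theta ord0 i) * z i y) by exact: gintZ.
have m3 i : gint theta sigma (fun y => (2 * sigma ^+ 2) * dg i y) by apply: gintZ; exact: d1.
have Mi i : gint theta sigma (M i) by apply: gintD => //; exact: gintD.
have M0 i : gexp theta sigma (M i) = 0.
  rewrite gexpD//; last exact: gintD.
  rewrite gexpD// (gexpZ _ (zg theta i sigma0 sb)) (gexpZ _ (zi i)) (gexpZ _ (d1 theta i sigma0 sb)).
  rewrite (gexp_coord lamP)// (stein lamP theta (wp i) sigma0 sb (g2i i) (dgi i)).
  by ring.
have SUREE : SURE sigma g dg = fun y => ((- (n%:R * sigma ^+ 2)) + sqnorm (y - theta))
    + (\sum_(i < n) L i y + \sum_(i < n) M i y).
  apply/funext => y; rewrite /SURE /sqnorm mulr_sumr -!big_split/= addrAC -addrA -!big_split/=.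
  rewrite [in LHS]addrC; congr (_ + _).
  by apply: eq_bigr => i _; rewrite /L /M /z !mxE; ring.
have S1 : gint theta sigma (fun y => (- (n%:R * sigma ^+ 2)) + sqnorm (y - theta)).
  by apply: gintD => //; exact: (gint_cst lamP theta (- (n%:R * sigma ^+ 2))).
have Ms : gint theta sigma (fun y => \sum_(i < n) M i y) by exact: gint_sum.
under [RHS]eq_integral do rewrite lossE.
rewrite (normal_gexp sigma0 muP lossi) SUREE (normal_gexp sigma0 muP); last first.
  by apply: gintD => //; exact: gintD.
congr EFin; rewrite gexpD//; last exact: gintD.
rewrite gexpD//; last exact: (gint_cst lamP theta (- (n%:R * sigma ^+ 2))).
rewrite (gexp_cst lamP theta (- (n%:R * sigma ^+ 2)))// (gexp_sqnorm lamP)// addNr add0r.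
by rewrite gexpD// (gexp_sum lamP _ sigma0 Mi) big1 ?addr0// => i _; exact: M0.
Qed.

End assembly.

Unset Implicit Arguments.
Set Strict Implicit.
Set Printing Implicit Defensive.

Theorem theorem2 (R : realType) (n : nat) (theta : 'rV[R]_n) (sigma beta : R)
    (lam : {measure set 'rV[R]_n -> \bar R})
    (muY mu0 muB : probability 'rV[R]_n R)
    (g : 'rV[R]_n -> 'rV[R]_n) (dg : 'I_n -> 'rV[R]_n -> R) :
  0 < sigma -> 0 < beta ->
  is_lebesgue_rV lam ->
  is_normal_rV muY theta sigma ->
  is_normal_rV mu0 0 sigma ->
  is_normal_rV muB theta (Num.sqrt (1 + beta) * sigma) ->
  (forall i : 'I_n, weakly_diff lam (fun y => g y ord0 i)) ->
  (forall i : 'I_n, weak_partial lam i (fun y => g y ord0 i) (dg i)) ->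
  muB.-integrable [set: 'rV[R]_n] (fun y => (sqnorm (g y))%:E) ->
  (forall i : 'I_n, muB.-integrable [set: 'rV[R]_n] (EFin \o dg i)) ->
  {ae muY, forall y,
     CB_inf mu0 sigma g a y @[a --> 0^'+] --> (SURE sigma g dg y)%:E} /\
  (\int[muY]_y (SURE sigma g dg y)%:E =
   \int[muY]_y (sqnorm (theta - g y))%:E)%E.
Proof.
move=> sigma0 beta0 lamP muYP mu0P muBP _ wp g2 dgi.
(* The standard deviation of the inflated law; [beta > 0] makes it strictly larger than [sigma], as
   needed to apply Stein's identity at width [sigma] itself. *)
pose b := Num.sqrt (1 + beta) * sigma.
have sqrt1 : 1 < Num.sqrt (1 + beta) by rewrite -[ltLHS]sqrtr1 ltr_sqrt ?ltrDl// addr_gt0.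
have b0 : 0 < b by rewrite mulr_gt0// (lt_trans ltr01).
have sb : sigma < b by rewrite ltr_pMl.
have mg i : measurable_fun setT (fun y => g y ord0 i) by case: (weak_partial_measurable (wp i)).
have sq_gi : gint lam theta b (fun y => sqnorm (g y)).
  apply: (normal_gint lamP b0 muBP) => //.
  by apply: measurable_sum => i; apply: measurable_funX; exact: mg.
have g2i i : gint lam theta b (fun y => g y ord0 i ^+ 2).
  apply: (gint_le _ sq_gi); first by apply: measurable_funX; exact: mg.
  by move=> y; rewrite !ger0_norm ?sqr_ge0 ?sqnorm_ge0 ?coord_sqr_le.
have dgi' i : gint lam theta b (dg i).
  by apply: (normal_gint lamP b0 muBP) => //; case: (weak_partial_measurable (wp i)).
split; last exact: (SURE_unbiased lamP sigma0 wp g2i dgi' sb muYP).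
apply: (normal_negligible lamP sigma0 muYP).
exact: (CB_inf_cvg lamP sigma0 b0 wp g2i dgi' mu0P).
Qed.
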